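(* Let $n\ge 1$, let $S\subset[n]^2$ be admissible, let $\bar A\in\mathscr{M}_S$ and $\bar b\in\mathbb{R}^n$ satisfy $\|\bar A\|_{\max}\le 1$ and $\|\bar b\|_\infty\le 1$, let $\sigma>0$, and let $A\sim N_S(\bar A,\sigma^2\mathrm{Id})$ and $b\sim N(\bar b,\sigma^2\mathrm{Id})$ be independent. Then, for every real number $t>2|S|$, $$\mathrm{Prob}\{\boldsymbol{c}(A,b)>t\}\;\le\;\left(\frac{1+\sigma}{\sigma}\right)\left(\frac{4n|S|^2}{t-2|S|}\right)\sqrt{\frac{2}{\pi}},$$ and, for all $\beta>1$, $$\mathbb{E}\big(\log_\beta \boldsymbol{c}(A,b)\big)\;\le\;\log_\beta\left(\frac{1+\sigma}{\sigma}\right)+2\log_\beta|S|+\log_\beta n+\frac{2.65}{\ln\beta}.$$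
   Context: Notation: $[n]=\{1,\dots,n\}$; $\mathscr{M}$ is the set of $n\times n$ real matrices; for $S\subseteq[n]^2$, $\mathscr{M}_S=\{A\in\mathscr{M}: a_{ij}=0 \text{ whenever } (i,j)\notin S\}$. The set $S$ is admissible if $\mathscr{M}_S$ contains some invertible matrix. $\|A\|_{\max}=\max_{i,j}|a_{ij}|$ and $\|b\|_\infty=\max_i|b_i|$. Random data: $A\sim N_S(\bar A,\sigma^2\mathrm{Id})$ means that the entries $a_{ij}$ with $(i,j)\in S$ are independent Gaussian random variables $a_{ij}\sim N(\bar a_{ij},\sigma^2)$, and $a_{ij}=0$ for $(i,j)\notin S$. Such $A$ is nonsingular with probability one when $S$ is admissible. $b\sim N(\bar b,\sigma^2\mathrm{Id})$ means that the $b_i\sim N(\bar b_i,\sigma^2)$ are independent. Componentwise condition number: For $u,v\in\mathbb{R}^p$ let $\frac{u}{v}=(w_1,\dots,w_p)$ with $w_i=u_i/v_i$ if $v_i\ne 0$, $w_i=0$ if $u_i=v_i=0$, and $w_i=\infty$ otherwise. Put $d(u,v)=\left\|\frac{u-v}{v}\right\|_\infty\in[0,\infty]$; when finite, $d(u,v)=\min\{\nu\ge 0: |u_i-v_i|\le\nu|v_i| \text{ for all } i\}$. For $\delta>0$ let $\mathcal{S}(a,\delta)=\{x\in\mathbb{R}^p: d(x,a)\le\delta\}$. For a continuous map $F:\mathcal{D}\to\mathbb{R}^q$, $\mathcal{D}\subseteq\mathbb{R}^p$, and $a\in\mathcal{D}$, the componentwise condition number of $F$ at $a$ is $$\boldsymbol{c}^F(a)=\lim_{\delta\to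 0}\ \sup_{x\in\mathcal{S}(a,\delta)\cap\mathcal{D},\ x\ne a}\frac{d(F(x),F(a))}{d(x,a)}\in[0,\infty].$$ Linear equation solving: for $A\in\mathscr{M}$ nonsingular and $b\in\mathbb{R}^n$ let $x=A^{-1}b$. For $k\in[n]$, $\boldsymbol{c}_k(A,b)$ is the componentwise condition number at $(A,b)$ of the map $(A,b)\mapsto x_k$ (defined on pairs with $A$ nonsingular), and $\boldsymbol{c}(A,b)=\max_{k\in[n]}\boldsymbol{c}_k(A,b)$. *)

(* Defs.v *)
From HB Require Import structures.
From mathcomp Require Export all_boot all_order all_algebra.
From mathcomp Require Export all_classical all_reals all_analysis.

Set Implicit Arguments.
Unset Strict Implicit.
Unset Printing Implicit Defensive.

Export Order.TTheory GRing.Theory Num.Theory.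
Export numFieldNormedType.Exports.

Local Open Scope classical_set_scope.
Local Open Scope ring_scope.

Section sparse_matrices.
Context {R : realType} {m n : nat}.
Implicit Types S : {set 'I_m * 'I_n}.

Definition supported_on S (A : 'M[R]_(m, n)) : Prop :=
  forall i j, (i, j) \notin S -> A i j = 0.

End sparse_matrices.

Definition admissible (R : realType) (n : nat) (S : {set 'I_n * 'I_n}) : Prop :=
  exists A : 'M[R]_n, supported_on S A /\ A \in unitmx.

Section componentwise_condition_number.
Context {R : realType}.

Definition cquot (x y : R) : \bar R :=
  if y != 0 then (x / y)%:E else if x == 0 then 0%E else +oo%E.

Definition cdist (p : nat) (u v : 'rV[R]_p) : \bar R :=
  \big[maxe/0%E]_(i < p) `|cquot (u ord0 i - v ord0 i) (v ord0 i)|%E.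

Definition cball (p : nat) (a : 'rV[R]_p) (delta : R) : set 'rV[R]_p :=
  [set x | (cdist x a <= delta%:E)%E].

(* The supremum is taken in [0, +oo], whence the outer maxe: it matters only
   when no x != a is available (e.g. a = 0), where ereal_sup set0 = -oo. *)
Definition cond_sup (p q : nat) (D : set 'rV[R]_p) (F : 'rV[R]_p -> 'rV[R]_q)
    (a : 'rV[R]_p) (delta : R) : \bar R :=
  maxe 0%E (ereal_sup [set (cdist (F x) (F a) / cdist x a)%E |
                        x in cball a delta `&` D `&` [set x | x != a]]).

(* Meaningful for a in D; F is only evaluated on D. *)
Definition cond (p q : nat) (D : set 'rV[R]_p) (F : 'rV[R]_p -> 'rV[R]_q)
    (a : 'rV[R]_p) : \bar R :=
  lim (cond_sup D F a delta @[delta --> 0^'+]).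

End componentwise_condition_number.

Section linear_equation_solving.
Context {R : realType} {n : nat}.

Definition pack (A : 'M[R]_n) (b : 'cV[R]_n) : 'rV[R]_(n * n + n) :=
  row_mx (mxvec A) b^T.

Definition unpack_mx (v : 'rV[R]_(n * n + n)) : 'M[R]_n := vec_mx (lsubmx v).

Definition unpack_rhs (v : 'rV[R]_(n * n + n)) : 'cV[R]_n := (rsubmx v)^T.

Definition solve_dom : set 'rV[R]_(n * n + n) :=
  [set v | unpack_mx v \in unitmx].

Definition solve (k : 'I_n) (v : 'rV[R]_(n * n + n)) : 'rV[R]_1 :=
  row k (invmx (unpack_mx v) *m unpack_rhs v).

Definition cond_lin_k (k : 'I_n) (A : 'M[R]_n) (b : 'cV[R]_n) : \bar R :=
  cond solve_dom (solve k) (pack A b).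

(* Convention: the condition number of a singular system is +oo. *)
Definition cond_lin (A : 'M[R]_n) (b : 'cV[R]_n) : \bar R :=
  if A \in unitmx then \big[maxe/-oo%E]_(k < n) cond_lin_k k A b else +oo%E.

End linear_equation_solving.

Section random_matrices.
Context {d : measure_display} {T : measurableType d} {R : realType}.
Variable P : probability T R.

Definition entry (m n : nat) (A : T -> 'M[R]_(m, n)) (k : 'I_m * 'I_n) : T -> R :=
  fun w => A w k.1 k.2.

Definition mutually_independent (I : finType) (S : {set I}) (X : I -> T -> R) :
    Prop :=
  forall (J : {set I}) (B : I -> set R),
    J \subset S -> (forall k, measurable (B k)) ->
    P (\bigcap_(k in [set` J]) (X k @^-1` B k)) =
    (\prod_(k in J) P (X k @^-1` B k))%E.

(* normal_prob takes the mean and the standard deviation. *)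
Definition gaussian_mx (m n : nat) (S : {set 'I_m * 'I_n})
    (Abar : 'M[R]_(m, n)) (sigma : R) (A : T -> 'M[R]_(m, n)) : Prop :=
  [/\ forall k, measurable_fun setT (entry A k),
      forall k, k \in S -> forall B : set R, measurable B ->
        P (entry A k @^-1` B) = normal_prob (Abar k.1 k.2) sigma B,
      mutually_independent S (entry A)
    & forall w, supported_on S (A w)].

Definition sigma_mx (m n : nat) (A : T -> 'M[R]_(m, n)) : set (set T) :=
  <<s [set E | exists k, exists2 B : set R, measurable B &
                                             E = entry A k @^-1` B] >>.

Definition independent_mx (m1 n1 m2 n2 : nat)
    (A : T -> 'M[R]_(m1, n1)) (b : T -> 'M[R]_(m2, n2)) : Prop :=
  forall E F, sigma_mx A E -> sigma_mx b F -> P (E `&` F) = (P E * P F)%E.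

End random_matrices.

Definition logb {R : realType} (beta x : R) : R := ln x / ln beta.

Definition logbe {R : realType} (beta : R) (x : \bar R) : \bar R :=
  (lne x / (ln beta)%:E)%E.

(* Main.v *)
From HB Require Import structures.
Require Import Defs.
From mathcomp Require Import all_boot all_order all_algebra.
From mathcomp Require Import all_classical all_reals all_analysis.
From mathcomp Require Import measurable_realfun ring lra.

Set Implicit Arguments.
Unset Strict Implicit.
Unset Printing Implicit Defensive.

Import Order.TTheory GRing.Theory Num.Theory.
Import numFieldNormedType.Exports.

Local Open Scope classical_set_scope.
Local Open Scope ring_scope.

(** Why the bounds hold.

    Let x = A^-1 b, and let M_k be A with b in place of column k. Outside a null event,
    A is invertible and x_k != 0, and the componentwise condition number of x_k is
    exactly Skeel's quotient (|A^-1| (|A| |x| + |b|))_k / |x_k|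
    ([cond_lin_k_regular]): this follows from the identity
    x' - x = A'^-1 ((b' - b) - (A' - A) x) and the continuity of inversion. By Cramer's
    rule, x_k = det M_k / det A, so that the relative errors of x_k come from those of
    two determinants. If in every column j of A and of M_k the absolute terms of the
    cofactor expansion add up to at most u times the absolute value of the determinant,
    then the condition number of x_k is at most 2 n u ([skeel_le]).

    The probabilistic part concerns a single column with m random entries X_i and
    cofactors g_i. The determinant is the linear form sum_i X_i g_i, and the cofactors
    are independent of the X_i. Given everything but X_i, the event
    sum |X_i g_i| > u |sum X_i g_i| confines X_i to a short interval, whose probability
    is at most its length times the maximum of the Gaussian density. Averaging over i
    with weights proportional to |g_i| bounds the probability of the event by
    2 (m - 1) C / (u - 1) with C = (1 + sigma) / sigma * sqrt (2 / pi)
    ([column_sum_tail]). Because this is linear in m - 1, the sum over all the columns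
    of A and of M_1, ..., M_n is 2 n (|S| - 1) C / (u - 1), although b makes the
    matrices M_k less sparse than A. With u = t / (2 n) the result is
    4 n^2 (|S| - 1) C / (t - 2 n) ([cond_lin_tail]), which is at most the required bound
    since n <= |S| for an admissible S. The same estimate, integrated from
    5 n |S|^2 (1 + sigma) / sigma on, bounds the expectation of the logarithm
    ([log_expectation_tail]).

    The condition number is a limit of suprema over uncountable sets, and P is
    not assumed complete. Its measurability ([measurable_cond_lin]) therefore
    needs its value at every point: if A is invertible and x_k = 0, it is 0 or +oo
    according to the zero pattern of (A, b) alone. *)

(** * Cramer's rule and Skeel's quotient *)

Section cramer.
Context {F : fieldType} {n : nat}.
Implicit Types (A : 'M[F]_n) (b : 'cV[F]_n) (k : 'I_n).

Definition replace_col A b k : 'M[F]_n :=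
  \matrix_(i, j) if j == k then b i ord0 else A i j.

(** The entry (k, i) of the inverse of an invertible A, written with a cofactor so
    that it is a rational function of the entries of A on all matrices: this makes
    its continuity and its measurability immediate. *)
Definition inv_entry A k i : F := (\det A)^-1 * cofactor A i k.

Definition sol_entry A b k : F := \sum_i inv_entry A k i * b i ord0.

Lemma invmx_entry A k i : A \in unitmx -> invmx A k i = inv_entry A k i.
Proof. by move=> Au; rewrite /invmx Au !mxE. Qed.

Lemma sol_entryE A b k : A \in unitmx -> (invmx A *m b) k ord0 = sol_entry A b k.
Proof.
by move=> Au; rewrite mxE; apply: eq_bigr => i _; rewrite invmx_entry.
Qed.

Lemma mulVmx_entry A j l : A \in unitmx ->
  \sum_i inv_entry A j i * A i l = (j == l)%:R.
Proof.
move=> Au; transitivity ((invmx A *m A) j l).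
  by rewrite mxE; apply: eq_bigr => i _; rewrite invmx_entry.
by rewrite mulVmx// mxE.
Qed.

Lemma cofactor_replace_col A b k i : cofactor (replace_col A b k) i k = cofactor A i k.
Proof.
rewrite /cofactor; congr (_ * \det _); apply/matrixP => x y; rewrite !mxE.
by rewrite eq_sym (negbTE (neq_lift _ _)).
Qed.

Lemma det_replace_col A b k : A \in unitmx ->
  \det (replace_col A b k) = \det A * sol_entry A b k.
Proof.
rewrite unitmxE unitfE => Au; rewrite (expand_det_col _ k) /sol_entry mulr_sumr.
apply: eq_bigr => i _; rewrite cofactor_replace_col mxE eqxx /inv_entry.
by move: (cofactor A i k) => c; field.
Qed.

(** By uniqueness of the solution of a linear system: multiplied by the matrix with
    b in column k, the row on the right has the same product as row j of the
    adjugate. The formula expresses the derivative of x_k = det M / det A in A i j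
    as the difference of the contributions of M and of A. *)
Lemma cofactor_replace_col_neq A b k i j : A \in unitmx ->
  sol_entry A b k != 0 -> j != k ->
  cofactor (replace_col A b k) i j = \det A *
    (inv_entry A j i * sol_entry A b k - inv_entry A k i * sol_entry A b j).
Proof.
move=> Au xk jk; set M := replace_col A b k.
have dA : \det A != 0 by rewrite -unitfE -unitmxE.
have Mu : M \in unitmx by rewrite unitmxE unitfE det_replace_col// mulf_neq0.
pose z : 'rV[F]_n := \row_i (\det A *
  (inv_entry A j i * sol_entry A b k - inv_entry A k i * sol_entry A b j)).
suff E : row j (\adj M) = z by have /rowP/(_ i) := E; rewrite !mxE.
have inj : injective (fun B : 'rV_n => B *m M) := can_inj (mulmxK Mu).
apply: inj; rewrite -row_mul mul_adj_mx.
apply/rowP => l; rewrite !mxE det_replace_col//.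
under eq_bigr => i' _ do rewrite !mxE -mulrA mulrBl ![_ * sol_entry _ _ _ * _]mulrAC.
rewrite -mulr_sumr big_split/= sumrN -!mulr_suml.
have [->|lk] := eqVneq l k.
  rewrite (negbTE jk) mulr0n -/(sol_entry A b j) -/(sol_entry A b k).
  by rewrite [sol_entry A b j * _]mulrC subrr mulr0.
rewrite !mulVmx_entry// [k == l]eq_sym (negbTE lk) mul0r subr0.
by case: eqVneq => _; rewrite ?mul1r ?mul0r ?mulr0.
Qed.

End cramer.

Section skeel.
Context {R : realFieldType} {n : nat}.
Implicit Types (A : 'M[R]_n) (b : 'cV[R]_n) (k : 'I_n).

Definition row_size A b i : R :=
  `|b i ord0| + \sum_j `|A i j| * `|sol_entry A b j|.

(** The componentwise condition number of Skeel:
    (|A^-1| (|A| |x| + |b|))_k / |x_k|, where x solves A x = b. *)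
Definition skeel A b k : R :=
  (\sum_i `|inv_entry A k i| * row_size A b i) / `|sol_entry A b k|.

(** Logarithmic differentiation of Cramer's rule x_k = det M / det A. Each of the
    n columns of M = replace_col A b k and of A contributes at most u: column k of M
    carries the perturbations of b, and column j of A those of A i j through det A,
    while for j != k the same entries occur once more in det M. *)
Lemma skeel_le A b k u : A \in unitmx -> sol_entry A b k != 0 ->
  (forall j, \sum_i `|A i j * cofactor A i j| <= u * `|\det A|) ->
  (forall j, \sum_i `|replace_col A b k i j * cofactor (replace_col A b k) i j|
             <= u * `|\det (replace_col A b k)|) ->
  skeel A b k <= 2 * n%:R * u.
Proof.
move=> Au xk colA colM; set x := sol_entry A b.
have dA : \det A != 0 by rewrite -unitfE -unitmxE.
have dA0 : 0 < `|\det A| by rewrite normr_gt0.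
have xk0 : 0 < `|x k| by rewrite normr_gt0.
have colA' j : \sum_i `|inv_entry A j i * A i j| <= u.
  rewrite -(ler_pM2r dA0) (le_trans _ (colA j))// mulr_suml ler_sum// => i _.
  rewrite -normrM le_eqVlt; apply/orP; left; apply/eqP; congr `|_|.
  by rewrite /inv_entry; move: (cofactor A i j) => c; field.
have colM' j : \sum_i `|replace_col A b k i j * cofactor (replace_col A b k) i j| <=
    u * `|x k| * `|\det A|.
  by rewrite (le_trans (colM j))// det_replace_col// normrM [`|_| * _]mulrC mulrA.
have cancel_det (y q : R) : `|y * (\det A * q)| / `|\det A| = `|y * q|.
  by rewrite mulrCA normrM mulrC mulKf ?gt_eqF.
have colb : \sum_i `|inv_entry A k i| * `|b i ord0| <= u * `|x k|.
  rewrite -(ler_pM2r dA0) (le_trans _ (colM' k))// mulr_suml ler_sum// => i _.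
  rewrite mxE eqxx cofactor_replace_col -!normrM le_eqVlt; apply/orP; left.
  apply/eqP; congr `|_|; rewrite /inv_entry.
  by move: (cofactor A i k) => c; field.
(* Column k of A does not occur in replace_col A b k, whence the saving when j = k. *)
have colj j : \sum_i `|inv_entry A k i| * (`|A i j| * `|x j|) <=
    (2 - (j == k)%:R) * (u * `|x k|).
  have [->|jk] := eqVneq j k.
    rewrite mulrA; under eq_bigr do rewrite mulrA -normrM; rewrite -mulr_suml.
    by rewrite (_ : 2 - 1 = 1) ?mul1r ?ler_wpM2r//; ring.
  rewrite subr0 mulr_natl mulr2n.
  apply: (@le_trans _ _ (\sum_i (`|inv_entry A j i * A i j| * `|x k| +
     `|replace_col A b k i j * cofactor (replace_col A b k) i j| / `|\det A|))).
    apply: ler_sum => i _; rewrite cofactor_replace_col_neq// mxE (negbTE jk).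
    rewrite cancel_det -!normrM; apply: le_trans (ler_normB _ _).
    rewrite le_eqVlt; apply/orP; left; apply/eqP; congr `|_|.
    by rewrite -/x; ring.
  rewrite big_split/= -!mulr_suml lerD// ?ler_wpM2r//.
  by rewrite ler_pdivrMr.
rewrite ler_pdivrMr// /row_size.
under eq_bigr do rewrite mulrDr mulr_sumr.
rewrite big_split/= exchange_big/=.
apply: (le_trans (lerD colb (ler_sum _ (fun j _ => colj j)))).
rewrite -mulr_suml sumrB sumr_const card_ord (bigD1 k)//= eqxx big1; last first.
  by move=> j /negbTE ->.
rewrite addr0 /= -[2 *+ n]mulr_natr le_eqVlt; apply/orP; left; apply/eqP.
by ring.
Qed.

End skeel.

(** * Componentwise distance *)

Section componentwise_distance.
Context {R : realType}.
Implicit Types p : nat.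

Lemma le_entry_mx_norm (m n : nat) (M : 'M[R]_(m, n)) i j : `|M i j| <= `|M|.
Proof.
rewrite [leRHS]/Num.norm/= mx_normrE.
exact: (le_bigmax _ (fun ij : 'I_m * 'I_n => `|M ij.1 ij.2|) (i, j)).
Qed.

Lemma abse_cquot_le (x y r : R) : 0 <= r ->
  (`|cquot x y| <= r%:E)%E = (`|x| <= r * `|y|).
Proof.
move=> r0; rewrite /cquot; have [->|y0] /= := eqVneq y 0; last first.
  by rewrite lee_fin normrM normfV ler_pdivrMr// normr_gt0.
rewrite normr0 mulr0; have [->|x0] := eqVneq x 0.
  by rewrite abse0 normr0 lexx lee_fin r0.
by rewrite normr_le0 (negbTE x0).
Qed.

Lemma cdist_ge0 p (u v : 'rV[R]_p) : (0 <= cdist u v)%E.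
Proof. exact: bigmax_ge_id. Qed.

Lemma cdist_leP p (u v : 'rV[R]_p) (r : R) : 0 <= r ->
  (cdist u v <= r%:E)%E <->
  (forall i, `|u ord0 i - v ord0 i| <= r * `|v ord0 i|).
Proof.
move=> r0; split=> [/bigmax_leP[_ H] i|H].
  by rewrite -abse_cquot_le//; exact: H.
by apply/bigmax_leP; split => [|i _]; rewrite ?lee_fin ?abse_cquot_le.
Qed.

Lemma cdist_gt0 p (u v : 'rV[R]_p) : u != v -> (0 < cdist u v)%E.
Proof.
move=> uv; rewrite lt_neqAle cdist_ge0 andbT eq_sym; apply: contra uv => /eqP d0.
have H : (cdist u v <= 0%:E)%E by rewrite d0.
apply/eqP/rowP => i; apply/eqP; rewrite -subr_eq0 -normr_le0.
by have /(cdist_leP _ _ (lexx 0))/(_ i) := H; rewrite mul0r.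
Qed.

Lemma cdist_fin p (u v : 'rV[R]_p) (delta : R) : (cdist u v <= delta%:E)%E ->
  exists2 r, cdist u v = r%:E & 0 <= r <= delta.
Proof.
have := cdist_ge0 u v; case: (cdist u v) => // r; rewrite !lee_fin => r0 rd.
by exists r => //; rewrite r0.
Qed.

Lemma cdist1 (u v : 'rV[R]_1) :
  cdist u v = `|cquot (u ord0 ord0 - v ord0 ord0) (v ord0 ord0)|%E.
Proof.
by rewrite /cdist big_ord_recl big_ord0 maxC; apply/max_idPr; rewrite abse_ge0.
Qed.

(** A componentwise ball of radius delta lies in the ball of radius delta * |a| for
    the max norm. *)
Lemma cball_near p (a : 'rV[R]_p) (Q : set 'rV[R]_p) :
  (\forall v \near a, Q v) ->
  \forall delta \near 0^'+, cball a delta `<=` Q.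
Proof.
move=> /nbhs_ballP[e /= e0 eQ].
have a1 : 0 < 1 + `|a| by rewrite ltr_pwDl.
near=> delta.
have d0 : 0 <= delta by near: delta; exact: nbhs_right_ge.
move=> v /(cdist_leP _ _ d0) H; apply: eQ; split=> // i j.
rewrite (ord1 i) /ball /= distrC (le_lt_trans (H j))//.
apply: (@le_lt_trans _ _ (delta * (1 + `|a|))).
  by rewrite ler_wpM2l// (le_trans (le_entry_mx_norm _ _ _))// lerDr.
rewrite -ltr_pdivlMr//; near: delta; apply: nbhs_right_lt.
by rewrite divr_gt0.
Unshelve. all: by end_near. Qed.

End componentwise_distance.

(** * Packed systems and their perturbations *)

Section matrix_continuity.
Context {R : realType} {V : Type} {F : set_system V} {FF : ProperFilter F}.

Lemma cvg_det n (M : V -> 'M[R]_n) (M0 : 'M[R]_n) :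
  (forall i j, M v i j @[v --> F] --> M0 i j) ->
  \det (M v) @[v --> F] --> \det M0.
Proof.
move=> cM; rewrite /determinant.
apply: cvg_big => [|s _]; first exact: add_continuous.
apply: cvgM; first exact: cvg_cst.
by apply: cvg_big => [|i _]; [exact: mul_continuous|exact: cM].
Qed.

Lemma cvg_inv_entry n (M : V -> 'M[R]_n) (M0 : 'M[R]_n) k i :
  M0 \in unitmx ->
  (forall i j, M v i j @[v --> F] --> M0 i j) ->
  inv_entry (M v) k i @[v --> F] --> inv_entry M0 k i.
Proof.
move=> M0u cM; apply: cvgM.
  by apply: cvgV; [rewrite -unitfE -unitmxE|exact: cvg_det].
apply: cvgM; first exact: cvg_cst.
apply: cvg_det => x y; under eq_cvg do rewrite !mxE.
by rewrite !mxE; exact: cM.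
Qed.

End matrix_continuity.

Section packing.
Context {R : realType} {n : nat}.
Implicit Types (A : 'M[R]_n) (b : 'cV[R]_n) (v : 'rV[R]_(n * n + n)).

Definition mx_coord (i j : 'I_n) : 'I_(n * n + n) := lshift n (mxvec_index i j).
Definition rhs_coord (i : 'I_n) : 'I_(n * n + n) := rshift (n * n) i.

Lemma coordP (x : 'I_(n * n + n)) :
  (exists i j, x = mx_coord i j) \/ (exists i, x = rhs_coord i).
Proof.
rewrite -(splitK x); case: (fintype.split x) => [y|i]; last by right; exists i.
by left; case/mxvec_indexP: y => i j; exists i, j.
Qed.

Lemma unpack_mxE v i j : unpack_mx v i j = v ord0 (mx_coord i j).
Proof. by rewrite !mxE. Qed.

Lemma unpack_rhsE v i : unpack_rhs v i ord0 = v ord0 (rhs_coord i).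
Proof. by rewrite !mxE. Qed.

Lemma unpack_mx_pack A b : unpack_mx (pack A b) = A.
Proof. by rewrite /unpack_mx /pack row_mxKl mxvecK. Qed.

Lemma unpack_rhs_pack A b : unpack_rhs (pack A b) = b.
Proof. by rewrite /unpack_rhs /pack row_mxKr trmxK. Qed.

Lemma solve_entry k v : solve_dom v ->
  solve k v ord0 ord0 = sol_entry (unpack_mx v) (unpack_rhs v) k.
Proof. by move=> Dv; rewrite mxE sol_entryE. Qed.

(** x' - x = A'^-1 (b' - A' x) and b - A x = 0. The identity is exact and carries the
    inverse of the perturbed matrix, so that no differentiation is needed. *)
Lemma sol_entry_perturb A b A' b' k : A \in unitmx -> A' \in unitmx ->
  sol_entry A' b' k - sol_entry A b k =
  \sum_i inv_entry A' k i * ((b' i ord0 - b i ord0) -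
     \sum_j (A' i j - A i j) * sol_entry A b j).
Proof.
move=> Au A'u; set x := invmx A *m b.
have xE j : sol_entry A b j = x j ord0 by rewrite sol_entryE.
have -> : sol_entry A' b' k - sol_entry A b k =
    (invmx A' *m ((b' - b) - (A' - A) *m x)) k ord0.
  rewrite mulmxBl [A *m x]mulKVmx// opprB addrA subrK mulmxBr mulKmx//.
  have -> : (invmx A' *m b' - x) k ord0 = (invmx A' *m b') k ord0 - x k ord0.
    by rewrite !mxE.
  by rewrite xE (sol_entryE _ _ A'u).
rewrite mxE; apply: eq_bigr => i _; rewrite invmx_entry// !mxE.
by congr (_ * (_ - _)); apply: eq_bigr => j _; rewrite xE !mxE.
Qed.

Lemma near_pack A b (e : R) k : A \in unitmx -> 0 < e ->
  \forall v \near pack A b, solve_dom v /\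
    (forall i, `|inv_entry (unpack_mx v) k i - inv_entry A k i| <= e).
Proof.
move=> Au e0.
have cM i j : unpack_mx v i j @[v --> pack A b] --> A i j.
  under eq_cvg do rewrite unpack_mxE.
  have -> : A i j = pack A b ord0 (mx_coord i j).
    by rewrite -unpack_mxE unpack_mx_pack.
  exact: coord_continuous.
have H1 : \forall v \near pack A b, \det (unpack_mx v) != 0.
  have d0 : \det A != 0 by rewrite -unitfE -unitmxE.
  exact: (cvgr_neq0 _ (cvg_det cM) d0).
have H2 : \forall v \near pack A b, forall i,
    `|inv_entry (unpack_mx v) k i - inv_entry A k i| <= e.
  have := @filter_forall _ 'I_n (fun i v =>
    `|inv_entry (unpack_mx v) k i - inv_entry A k i| <= e) _ (nbhs_filter (pack A b)).
  apply => i; have ci : inv_entry (unpack_mx v) k i @[v --> pack A b] --> inv_entry A k i.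
    have FF := @nbhs_pfilter _ (pack A b).
    by apply: (cvg_inv_entry (FF := FF) (M := @unpack_mx R n)).
  move/cvgrPdist_le: ci => /(_ e e0).
  by apply: filterS => v; rewrite distrC.
apply: filterS2 H1 H2 => v dv H.
by split => //; rewrite /solve_dom /= unitmxE unitfE.
Qed.

End packing.

(** * The condition number when x_k is nonzero *)

Section condition_formula.
Context {R : realType} {n : nat}.
Variables (A : 'M[R]_n) (b : 'cV[R]_n) (k : 'I_n).
Hypothesis Au : A \in unitmx.
Let a := pack A b.
Let D : set 'rV[R]_(n * n + n) := solve_dom.
Let F := solve (R := R) k.
Let x := sol_entry A b.

Let Da : D a. Proof. by rewrite /D /solve_dom /= unpack_mx_pack. Qed.

Let Fa : F a ord0 ord0 = x k.
Proof. by rewrite /F solve_entry// unpack_mx_pack unpack_rhs_pack. Qed.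

Let mx_pert v r : 0 <= r -> (cdist v a <= r%:E)%E ->
  forall i j, `|unpack_mx v i j - A i j| <= r * `|A i j|.
Proof.
move=> r0 /(cdist_leP _ _ r0) H i j; have := H (mx_coord i j).
by rewrite -!unpack_mxE /a unpack_mx_pack.
Qed.

Let rhs_pert v r : 0 <= r -> (cdist v a <= r%:E)%E ->
  forall i, `|unpack_rhs v i ord0 - b i ord0| <= r * `|b i ord0|.
Proof.
move=> r0 /(cdist_leP _ _ r0) H i; have := H (rhs_coord i).
by rewrite -!unpack_rhsE /a unpack_rhs_pack.
Qed.

Let solve_pert_le v r : D v -> 0 <= r -> (cdist v a <= r%:E)%E ->
  `|F v ord0 ord0 - x k| <=
  r * \sum_i `|inv_entry (unpack_mx v) k i| * row_size A b i.
Proof.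
move=> Dv r0 dv; rewrite /F solve_entry// sol_entry_perturb//.
rewrite (le_trans (ler_norm_sum _ _ _))// mulr_sumr ler_sum// => i _.
rewrite normrM mulrCA ler_wpM2l// (le_trans (ler_normB _ _))// mulrDr lerD//.
  exact: rhs_pert.
rewrite (le_trans (ler_norm_sum _ _ _))// mulr_sumr ler_sum// => j _.
by rewrite normrM mulrA ler_wpM2r//; exact: mx_pert.
Qed.

Hypothesis xk : x k != 0.

Let skeel_pm (e : R) := (\sum_i (`|inv_entry A k i| + e) * row_size A b i) / `|x k|.

Let row_size_ge0 i : 0 <= row_size A b i.
Proof. by rewrite addr_ge0// sumr_ge0// => j _; rewrite mulr_ge0. Qed.

Let cdist_solve v : D v -> cdist (F v) (F a) = (`|F v ord0 ord0 - x k| / `|x k|)%:E.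
Proof. by move=> Dv; rewrite cdist1 Fa /cquot xk /= normrM normfV. Qed.

Let cond_sup_le e delta : 0 <= e -> 0 < delta ->
  (forall v, cball a delta v -> forall i,
     `|inv_entry (unpack_mx v) k i - inv_entry A k i| <= e) ->
  (cond_sup D F a delta <= (skeel_pm e)%:E)%E.
Proof.
move=> e0 d0 He; rewrite /cond_sup ge_max lee_fin; apply/andP; split.
  by rewrite divr_ge0// sumr_ge0// => i _; rewrite mulr_ge0// addr_ge0.
apply: ub_ereal_sup => _ [v [[vd Dv] va] <-].
have [r rE /andP[r0 rd]] := cdist_fin vd.
have {}r0 : 0 < r by rewrite -lte_fin -rE cdist_gt0.
rewrite cdist_solve// rE inver gt_eqF// -EFinM lee_fin /skeel_pm.
rewrite mulrAC ler_pM2r ?invr_gt0 ?normr_gt0// ler_pdivrMr// mulrC.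
apply: (le_trans (solve_pert_le Dv (ltW r0) _)); first by rewrite rE.
rewrite ler_pM2l// ler_sum// => i _; rewrite ler_wpM2r//.
by rewrite addrC -lerBlDr (le_trans (lerB_dist _ _))// He.
Qed.

(** The perturbation whose contributions to x_k all have the same sign when the
    inverse of A is kept fixed. *)
Let worst delta : 'rV[R]_(n * n + n) :=
  pack (\matrix_(i, j) (A i j * (1 - delta * (Num.sg (inv_entry A k i) *
          Num.sg (A i j) * Num.sg (x j)))))
       (\col_i (b i ord0 * (1 + delta * (Num.sg (inv_entry A k i) *
          Num.sg (b i ord0))))).

Let worst_cball delta : 0 <= delta -> cball a delta (worst delta).
Proof.
move=> d0; apply/cdist_leP => // c.
have sg1 (y : R) : `|Num.sg y| <= 1 by rewrite normr_sg lern1 leq_b1.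
have [[i [j ->]]|[i ->]] := coordP c.
  rewrite -!unpack_mxE /a !unpack_mx_pack mxE.
  rewrite mulrBr mulr1 addrC addKr normrN !normrM mulrC ler_wpM2r// ger0_norm//.
  rewrite -[leRHS]mulr1 ler_wpM2l// -[leRHS]mulr1 ler_pM// ?mulr_ge0//.
  by rewrite -[leRHS]mulr1 ler_pM.
rewrite -!unpack_rhsE /a !unpack_rhs_pack mxE.
rewrite mulrDr mulr1 addrC addKr !normrM mulrC ler_wpM2r// ger0_norm//.
by rewrite -[leRHS]mulr1 ler_wpM2l// -[leRHS]mulr1 ler_pM.
Qed.

Let le_cond_sup e delta : 0 < delta -> D (worst delta) ->
  (forall i, `|inv_entry (unpack_mx (worst delta)) k i - inv_entry A k i| <= e) ->
  ((skeel_pm (- e))%:E <= cond_sup D F a delta)%E.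
Proof.
move=> d0 Dw He; set v := worst delta.
have dF : F v ord0 ord0 - x k = delta * \sum_i
    inv_entry (unpack_mx v) k i * (Num.sg (inv_entry A k i) * row_size A b i).
  rewrite /F solve_entry// sol_entry_perturb// mulr_sumr; apply: eq_bigr => i _.
  rewrite mulrCA; congr (_ * _); rewrite /v unpack_mx_pack unpack_rhs_pack !mxE.
  rewrite /row_size [in RHS]mulrDr [in RHS]mulrDr -sumrN; congr (_ + _).
    by rewrite normrEsg; ring.
  rewrite !mulr_sumr; apply: eq_bigr => j _.
  by rewrite mxE !normrEsg -/x; ring.
have lowF : skeel_pm (- e) <= `|F v ord0 ord0 - x k| / `|x k| / delta.
  rewrite [leRHS]mulrAC ler_pM2r ?invr_gt0 ?normr_gt0// dF normrM gtr0_norm//.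
  rewrite mulrC mulKf ?gt_eqF// (le_trans _ (ler_norm _))// ler_sum// => i _.
  rewrite mulrA ler_wpM2r// -[X in X - e]mulr1.
  set g' := inv_entry (unpack_mx v) k i; set g := inv_entry A k i.
  have -> : g' * Num.sg g = `|g| + (g' - g) * Num.sg g by rewrite normrEsg; ring.
  rewrite mulr1 lerD2l lerNl (le_trans (ler_norm _))// normrN normrM.
  rewrite (le_trans _ (He i))// -[leRHS]mulr1 ler_wpM2l//.
  by rewrite normr_sg lern1 leq_b1.
have [va|va] := eqVneq v a.
  rewrite /cond_sup le_max; apply/orP; left; rewrite lee_fin (le_trans lowF)//.
  by rewrite va Fa subrr normr0 !mul0r.
rewrite /cond_sup le_max; apply/orP; right.
have vd := worst_cball (ltW d0).
have [r rE /andP[r0 rd]] := cdist_fin vd.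
have {}r0 : 0 < r by rewrite -lte_fin -rE cdist_gt0.
apply: (@le_trans _ _ (cdist (F v) (F a) / cdist v a)%E); last first.
  by apply: ereal_sup_ubound; exists v.
rewrite cdist_solve// rE inver gt_eqF// -EFinM lee_fin (le_trans lowF)//.
by rewrite ler_wpM2l ?divr_ge0// lef_pV2.
Qed.

(** The perturbation identity bounds every quotient in the definition by the Skeel
    quotient formed with the inverse of the perturbed matrix, and the worst
    perturbation attains this, except that its signs come from the inverse of A; both tend to the Skeel quotient of (A, b)
    because matrix inversion is continuous. *)
Lemma cond_lin_k_regular : cond_lin_k k A b = (skeel A b k)%:E.
Proof.
have key (e : R) : 0 < e -> \forall delta \near 0^'+,
    ((skeel A b k - e)%:E <= cond_sup D F a delta <= (skeel A b k + e)%:E)%E.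
  move=> e0; pose S := \sum_i row_size A b i.
  have S0 : 0 <= S by exact: sumr_ge0.
  have S1 : 0 < 1 + S by rewrite ltr_pwDl.
  have x0 : 0 < `|x k| by rewrite normr_gt0.
  pose e' := e * `|x k| / (1 + S).
  have e'0 : 0 < e' by rewrite divr_gt0// mulr_gt0.
  have pmE t : skeel_pm t = skeel A b k + t * (S / `|x k|).
    rewrite /skeel_pm /skeel -/x mulrA -mulrDl; congr (_ / _).
    by rewrite mulr_sumr -big_split; apply: eq_bigr => i _; rewrite mulrDl.
  have Se : e' * (S / `|x k|) <= e.
    rewrite (_ : e' * _ = e * (S / (1 + S))); last first.
      by rewrite /e'; field; rewrite !gt_eqF.
    by rewrite -[leRHS]mulr1 ler_wpM2l ?(ltW e0)// ler_pdivrMr// mul1r lerDr.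
  have := cball_near (near_pack b k Au e'0).
  apply: filterS2 (nbhs_right_gt 0) => delta d0 sub.
  have Hv v : cball a delta v -> forall i,
      `|inv_entry (unpack_mx v) k i - inv_entry A k i| <= e'.
    by move=> /sub[].
  have [Dw Hw] := sub _ (worst_cball (ltW d0)).
  apply/andP; split.
    apply: le_trans (le_cond_sup d0 Dw Hw).
    by rewrite lee_fin pmE lerD2l mulNr lerN2.
  apply: le_trans (cond_sup_le (ltW e'0) d0 Hv) _.
  by rewrite lee_fin pmE lerD2l.
apply/cvg_lim => //; apply/fine_cvgP; split.
  apply: filterS (key 1 ltr01) => delta /andP[lo hi].
  by rewrite fin_numE; move: lo hi; case: (cond_sup _ _ _ _).
apply/cvgrPdist_le => e e0; apply: filterS (key e e0) => delta /andP[lo hi] /=.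
move: lo hi; case: (cond_sup _ _ _ _) => // r; rewrite !lee_fin /= ler_distl => lo hi.
by rewrite lerBlDr hi /= -lerBlDr lo.
Qed.

End condition_formula.

(** * The condition number when x_k vanishes *)

Section degenerate_condition.
Context {R : realType} {n : nat}.

Lemma exists_small_nonroot (p : {poly R}) (eta : R) : p != 0 -> 0 < eta ->
  exists2 s, 0 < s <= eta & p.[s] != 0.
Proof.
move=> p0 e0; pose rs := [seq eta / i.+1%:R | i <- iota 0 (size p)].
have urs : uniq rs.
  rewrite map_inj_uniq ?iota_uniq// => i j /(mulfI (lt0r_neq0 e0)) /invr_inj /eqP.
  by rewrite eqr_nat eqSS => /eqP.
have : ~~ all (root p) rs.
  apply/negP => /(max_poly_roots p0) /(_ urs).
  by rewrite size_map size_iota ltnn.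
case/allPn => _ /mapP[i _ ->] nr; exists (eta / i.+1%:R) => //.
by rewrite divr_gt0//= ler_pdivrMr// ler_peMr ?(ltW e0)// ler1n.
Qed.

Lemma det_segment (M N : 'M[R]_n) :
  exists p : {poly R}, forall s, p.[s] = \det (M + s *: (N - M)).
Proof.
exists (\det (\matrix_(i, j) ((M i j)%:P + (N i j - M i j) *: 'X))) => s.
rewrite -[LHS]/(horner_eval s _) -det_map_mx; congr (\det _).
apply/matrixP => i j; rewrite !mxE.
transitivity (((M i j)%:P + (N i j - M i j) *: 'X).[s]) => //.
by rewrite !hornerE mulrC.
Qed.

Lemma segment_entry m p (u v : 'M[R]_(m, p)) s i j :
  (u + s *: (v - u)) i j = u i j + s * (v i j - u i j).
Proof. by rewrite !mxE. Qed.

(** Component k of the solution is identically zero on the systems whose zero pattern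
    contains Z. When x_k = 0 the condition number is decided by this property, hence
    by the zero pattern of the data alone; as there are finitely many patterns, the
    condition number stays measurable on this null event. *)
Definition vanishing (k : 'I_n) (Z : {set 'I_(n * n + n)}) : Prop :=
  forall v : 'rV[R]_(n * n + n), solve_dom v ->
    (forall i, i \in Z -> v ord0 i = 0) -> solve k v ord0 ord0 = 0.

Variables (A : 'M[R]_n) (b : 'cV[R]_n) (k : 'I_n).
Hypothesis Au : A \in unitmx.
Hypothesis xk0 : sol_entry A b k = 0.
Let a := pack A b.

Let Da : solve_dom a. Proof. by rewrite /solve_dom /= unpack_mx_pack. Qed.

Let Fa : solve k a ord0 ord0 = 0.
Proof. by rewrite solve_entry// unpack_mx_pack unpack_rhs_pack. Qed.

Lemma cond_lin_k_vanishing : vanishing k [set i | a ord0 i == 0]%SET ->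
  cond_lin_k k A b = 0%E.
Proof.
move=> Z; apply/cvg_lim => //; apply: cvg_near_cst.
apply: filterS (nbhs_right_gt 0) => delta d0.
rewrite /cond_sup; apply/max_idPl; apply: ub_ereal_sup => _ [v [[vd Dv] va] <-].
rewrite cdist1 Fa (Z v Dv) ?subrr ?/cquot ?eqxx ?abse0 ?mul0e// => i.
rewrite inE => /eqP ai0.
have /(cdist_leP _ _ (ltW d0))/(_ i) := vd.
by rewrite -/a ai0 subr0 normr0 mulr0 normr_le0 => /eqP.
Qed.

(** Along the segment from the data to a system with x_k != 0 and the same zeros, the
    determinants of A and of replace_col A b k are nonzero polynomials in the
    parameter. Hence arbitrarily small relative perturbations make x_k nonzero, which
    is an infinite relative error. *)
Lemma cond_lin_k_nonvanishing : ~ vanishing k [set i | a ord0 i == 0]%SET ->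
  cond_lin_k k A b = +oo%E.
Proof.
move=> nZ.
have [v [Dv vZ Fv]] : exists v : 'rV[R]_(n * n + n), [/\ solve_dom v,
    forall i, a ord0 i = 0 -> v ord0 i = 0 & solve k v ord0 ord0 != 0].
  apply: contrapT => H; apply: nZ => v Dv vZ; apply/eqP/negPn/negP => Fv.
  by apply: H; exists v; split => // i ai; apply: vZ; rewrite inE ai.
have [p pE] := det_segment A (unpack_mx v).
have [q qE] := det_segment (replace_col A b k)
  (replace_col (unpack_mx v) (unpack_rhs v) k).
have dA : \det A != 0 by rewrite -unitfE -unitmxE.
have p0 : p != 0.
  apply: contraNneq dA => p0; have := pE 0.
  by rewrite p0 horner0 scale0r addr0 => <-.
have q0 : q != 0.
  have : q.[1] != 0.
    rewrite qE scale1r addrC subrK det_replace_col// -solve_entry//.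
    by rewrite mulf_neq0// -unitfE -unitmxE.
  by apply: contraNneq => ->; rewrite horner0.
(* C bounds every relative displacement |v_i - a_i| / |a_i|; the quotient is 0 when
   a_i = 0, and then v_i = 0 as well. *)
pose C := \sum_i `|v ord0 i - a ord0 i| / `|a ord0 i|.
have C0 : 0 < 1 + C by rewrite ltr_pwDl// sumr_ge0.
apply/cvg_lim => //; apply: cvg_near_cst.
apply: filterS (nbhs_right_gt 0) => delta d0.
have [s /andP[s0 sd] ps] := exists_small_nonroot (mulf_neq0 p0 q0) (divr_gt0 d0 C0).
pose w := a + s *: (v - a).
have wA : unpack_mx w = A + s *: (unpack_mx v - A).
  apply/matrixP => i j; rewrite segment_entry unpack_mxE segment_entry.
  by rewrite -!unpack_mxE /a unpack_mx_pack.
have wb : unpack_rhs w = b + s *: (unpack_rhs v - b).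
  apply/matrixP => i j; rewrite (ord1 j) segment_entry unpack_rhsE segment_entry.
  by rewrite -!unpack_rhsE /a unpack_rhs_pack.
have [pw qw] : p.[s] != 0 /\ q.[s] != 0.
  by move: ps; rewrite hornerM mulf_eq0 negb_or => /andP.
have Dw : solve_dom w.
  by rewrite /solve_dom /= wA unitmxE unitfE -pE.
have Fw : solve k w ord0 ord0 != 0.
  move: qw; rewrite qE.
  have -> : replace_col A b k +
      s *: (replace_col (unpack_mx v) (unpack_rhs v) k - replace_col A b k) =
      replace_col (unpack_mx w) (unpack_rhs w) k.
    by apply/matrixP => i j; rewrite wA wb !mxE; case: ifP => // _; rewrite !mxE.
  by rewrite det_replace_col// mulf_eq0 negb_or -solve_entry// => /andP[].
have wd : cball a delta w.
  apply/(cdist_leP _ _ (ltW d0)) => i.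
  have -> : w ord0 i - a ord0 i = s * (v ord0 i - a ord0 i).
    by rewrite segment_entry addrAC subrr add0r.
  have [ai0|ai0] := eqVneq (a ord0 i) 0.
    by rewrite ai0 (vZ _ ai0) subrr mulr0 !normr0 mulr0.
  have ai : 0 < `|a ord0 i| by rewrite normr_gt0.
  rewrite -ler_pdivrMr// normrM gtr0_norm// -mulrA.
  have Ci : `|v ord0 i - a ord0 i| / `|a ord0 i| <= 1 + C.
    rewrite /C (bigD1 i)//= addrCA lerDl addr_ge0//.
    by apply: sumr_ge0 => j _; exact: divr_ge0.
  apply: (le_trans (ler_wpM2l (ltW s0) Ci)).
  by rewrite -ler_pdivlMr.
have wa : w != a by apply: contraNneq Fw => ->; rewrite Fa.
apply/eqP; rewrite -leye_eq /cond_sup le_max; apply/orP; right.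
have [r rE /andP[r0 rd]] := cdist_fin wd.
have {}r0 : 0 < r by rewrite -lte_fin -rE cdist_gt0.
apply: (@le_trans _ _ (cdist (solve k w) (solve k a) / cdist w a)%E); last first.
  by apply: ereal_sup_ubound; exists w.
rewrite cdist1 Fa subr0 /cquot eqxx (negbTE Fw) /= rE inver gt_eqF//.
by rewrite gt0_mulye// lte_fin invr_gt0.
Qed.

End degenerate_condition.

(** * Independent families and conditional integration *)

Section fubini_independence.
Local Open Scope ereal_scope.
Context {d : measure_display} {T : measurableType d} {R : realType}.
Variable P : probability T R.

(** The joint law of Y and X is a product measure, so that Tonelli applies. *)
Lemma ge0_integral_independent {d1 d2} {T1 : measurableType d1}
    {T2 : measurableType d2} (Y : T -> T1) (X : T -> T2)
    (mu : probability T2 R) (f : T1 * T2 -> \bar R) :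
  measurable_fun setT Y -> measurable_fun setT X ->
  (forall A B, measurable A -> measurable B ->
    P (Y @^-1` A `&` X @^-1` B) = P (Y @^-1` A) * mu B) ->
  measurable_fun [set: T1 * T2] f -> (forall z, 0 <= f z) ->
  \int[P]_w f (Y w, X w) = \int[P]_w \int[mu]_x f (Y w, x).
Proof.
move=> mY mX indXY mf f0.
pose Y' : {mfun T >-> T1} := HB.pack Y (isMeasurableFun.Build _ _ _ _ _ mY).
pose Z : T -> T1 * T2 := fun w => (Y w, X w).
have mZ : measurable_fun setT Z by apply/measurable_fun_pairP.
transitivity (\int[pushforward P Z]_z f z).
  by rewrite ge0_integral_pushforward.
transitivity (\int[(distribution P Y' \x mu)%E]_z f z).
  apply: eq_measure_integral => A mA _; apply/esym.
  exact: product_measure_unique.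
rewrite fubini_tonelli1//.
rewrite ge0_integral_distribution//.
  exact: measurable_fun_fubini_tonelli_F.
by move=> y; exact: integral_ge0.
Qed.

End fubini_independence.

Section independent_families.
Local Open Scope ereal_scope.
Context {d : measure_display} {T : measurableType d} {R : realType}.
Variable P : probability T R.
Variables (I : finType) (X : I -> T -> R).

Definition cylinders (J : {set I}) : set (set T) :=
  [set E | exists2 B : I -> set R, forall k, measurable (B k) &
    E = \bigcap_(k in [set` J]) X k @^-1` B k].

Definition adapted (J : {set I}) (f : T -> R) : Prop :=
  measurable_fun [set: g_sigma_algebraType (cylinders J)] f.

Hypothesis mX : forall k, measurable_fun setT (X k).

Lemma cylindersI J : setI_closed (cylinders J).
Proof.
move=> _ _ [B mB ->] [B' mB' ->]; exists (fun k => B k `&` B' k).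
  by move=> k; exact: measurableI.
by rewrite -bigcapI; apply: eq_bigcapr.
Qed.

Lemma cylinders_measurable J : cylinders J `<=` measurable.
Proof.
move=> _ [B mB ->]; apply: fin_bigcap_measurable => // k _.
by rewrite -[X in measurable X]setTI; exact: mX.
Qed.

Lemma sigma_cylinders_measurable J : <<s cylinders J >> `<=` @measurable d T.
Proof.
apply: smallest_sub; last exact: cylinders_measurable.
exact: sigma_algebra_measurable.
Qed.

Lemma measurable_id_cylinders J :
  measurable_fun [set: T] (id : T -> g_sigma_algebraType (cylinders J)).
Proof.
by move=> _ A mA; rewrite setTI; exact: (@sigma_cylinders_measurable J).
Qed.

Lemma adapted_measurable J f : adapted J f -> measurable_fun [set: T] f.
Proof.
by move=> mf _ B mB; rewrite setTI; apply: (@sigma_cylinders_measurable J);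
  rewrite -[X in <<s _ >> X]setTI; exact: mf.
Qed.

Lemma adapted_entry (J : {set I}) (k : I) : k \in J -> adapted J (X k).
Proof.
move=> kJ _ B mB; rewrite setTI; apply: sub_sigma_algebra.
exists (fun l => if l == k then B else setT).
  by move=> l; case: ifP.
apply/seteqP; split => [w XB l lJ|w /(_ k kJ)] /=.
  by case: ifP => // /eqP ->.
by rewrite eqxx.
Qed.

Lemma adaptedS (J J' : {set I}) f : J \subset J' -> adapted J f -> adapted J' f.
Proof.
move=> JJ' mf _ B mB; rewrite setTI.
have : <<s cylinders J >> (f @^-1` B) by rewrite -[X in <<s _ >> X]setTI; exact: mf.
apply: smallest_sub; first exact: smallest_sigma_algebra.
move=> _ [D mD ->]; apply: sub_sigma_algebra.
exists (fun l => if l \in J then D l else setT).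
  by move=> l; case: ifP.
apply/seteqP; split => w /= XD l /= lJ.
  by case: ifP => // lJ'; exact: XD.
by have := XD l (fintype.subsetP JJ' _ lJ); rewrite lJ.
Qed.

Hypothesis indX : forall B : I -> set R, (forall k, measurable (B k)) ->
  P (\bigcap_k (X k @^-1` B k)) = \prod_k P (X k @^-1` B k).

Lemma independent_cylinder (J : {set I}) (k : I) B D : k \notin J -> cylinders J D ->
  measurable B -> P (D `&` X k @^-1` B) = P D * P (X k @^-1` B).
Proof.
move=> kJ [C mC ->] mB.
have PT : P [set: T] = 1 by exact: probability_setT.
pose C1 l := if l \in J then C l else setT.
pose C2 l := if l == k then B else C1 l.
have mC1 l : measurable (C1 l) by rewrite /C1; case: ifP.
have mC2 l : measurable (C2 l) by rewrite /C2; case: ifP.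
have E1 : \bigcap_(l in [set` J]) X l @^-1` C l = \bigcap_l X l @^-1` C1 l.
  apply/seteqP; split => w H l.
    by move=> _; rewrite /C1 /=; case: ifP => // lJ; exact: H.
  by move=> lJ; have := H l Logic.I; rewrite /C1 /= (lJ : l \in J).
have E2 : \bigcap_l X l @^-1` C1 l `&` X k @^-1` B = \bigcap_l X l @^-1` C2 l.
  apply/seteqP; split => w.
    move=> [H HB] l _ /=; rewrite /C2; case: ifP => [/eqP -> //|_].
    exact: (H l).
  move=> H; split; last by have := H k Logic.I; rewrite /C2 /= eqxx.
  move=> l _ /=; have := H l Logic.I; rewrite /C2 /=; case: ifP => // /eqP -> _.
  by rewrite /C1 (negbTE kJ).
rewrite E1 E2 !indX// (bigD1 k)//= [in RHS](bigD1 k)//=.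
have -> : C2 k = B by rewrite /C2 eqxx.
have -> : C1 k = setT by rewrite /C1 (negbTE kJ).
rewrite preimage_setT PT mul1e muleC.
by congr (_ * _); apply: eq_bigr => l lk; rewrite /C2 (negbTE lk).
Qed.

Lemma independent_sigma (J : {set I}) (k : I) B D : k \notin J -> <<s cylinders J >> D ->
  measurable B -> P (D `&` X k @^-1` B) = P D * P (X k @^-1` B).
Proof.
move=> kJ sD mB.
have mXB : measurable (X k @^-1` B) by rewrite -[X in measurable X]setTI; exact: mX.
have mG D' : <<s cylinders J >> D' -> measurable D'.
  exact: sigma_cylinders_measurable.
move: D sD.
apply: (@dynkin_induction _ (g_sigma_algebraType (cylinders J))) => //.
- exact: cylindersI.
- by rewrite setTI probability_setT mul1e.
- by move=> D GD; exact: (independent_cylinder kJ GD mB).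
- move=> D /mG mD PD.
  rewrite setIC -setDE measureD//; last by rewrite ltey_eq fin_num_measure.
  rewrite probability_setC// muleBl ?fin_num_measure// ?fin_num_adde_defl//.
    by rewrite mul1e -PD [D `&` _]setIC.
- move=> F mF tF PF.
  rewrite setI_bigcupl !measure_bigcup//; last 3 first.
  + by move=> n _; exact: (mG _ (mF n)).
  + by move=> n _; exact: (measurableI _ _ (mG _ (mF n)) mXB).
  + exact: trivIset_setIr.
  rewrite -[P (X k @^-1` B)]fineK ?fin_num_measure// muleC -nneseriesZl//.
  by apply: eq_eseriesr => n _; rewrite fineK ?fin_num_measure// muleC; exact: PF.
Qed.

(** Integrating out one variable of an independent family, the other ones being fixed:
    the identity of T, with the sigma-algebra of the X j for j in J as target, plays
    the role of the other variables. *)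
Lemma ge0_integral_entry (J : {set I}) (k : I) (mu : probability (measurableTypeR R) R)
    (f : g_sigma_algebraType (cylinders J) * measurableTypeR R -> \bar R) :
  k \notin J -> (forall B, measurable B -> P (X k @^-1` B) = mu B) ->
  measurable_fun [set: _ * _] f -> (forall z, 0 <= f z) ->
  \int[P]_w f (w, X k w) = \int[P]_w \int[mu]_x f (w, x).
Proof.
move=> kJ Pk mf f0.
have := @ge0_integral_independent _ _ _ P _ _
  (g_sigma_algebraType (cylinders J)) (measurableTypeR R) id (X k) mu f.
apply => //; first exact: measurable_id_cylinders.
  exact: mX.
by move=> A B mA mB; rewrite -Pk//; exact: (independent_sigma kJ mA mB).
Qed.

End independent_families.

(** * Gaussian small balls and first moments *)

Section normal_estimates.
Context {R : realType}.
Implicit Types m s c h x : R.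
Local Notation mu := (@lebesgue_measure R).

Lemma normal_peakE s : 0 < s -> normal_peak s *+ 2 = Num.sqrt (2 / pi) / s.
Proof.
move=> s0; rewrite /normal_peak -[s ^+ 2 * pi *+ 2]mulrnAr sqrtrM ?sqr_ge0//.
rewrite sqrtr_sqr gtr0_norm// invfM -mulrnAr mulrC; congr (_ / _).
have pi2 : 0 < pi *+ 2 :> R by rewrite pmulrn_lgt0// pi_gt0.
apply/eqP; rewrite -(@eqrXn2 _ 2) ?mulrn_wge0 ?invr_ge0 ?sqrtr_ge0//.
rewrite sqr_sqrtr; last by rewrite divr_ge0// pi_ge0.
rewrite exprMn_n exprVn sqr_sqrtr ?ltW//; apply/eqP.
move: (pi : R) (@pi_gt0 R) => p p0; field.
by rewrite gt_eqF.
Qed.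

Lemma normal_prob_ball m s c h : 0 < s -> 0 <= h ->
  (normal_prob m s [set x : R | (`|x - c| <= h)%R] <=
   (Num.sqrt (2 / pi) / s * h)%:E)%E.
Proof.
move=> s0 h0; have sn0 : s != 0 by rewrite gt_eqF.
have -> : [set x : R | `|x - c| <= h] = `[c - h, c + h]%classic.
  by apply/seteqP; split => x; rewrite /= in_itv/= ler_distl.
apply: (@le_trans _ _ (\int[mu]_(x in `[(c - h)%R, (c + h)%R]) (normal_peak s)%:E)%E).
  apply: ge0_le_integral => //=.
  - by move=> x _; rewrite lee_fin normal_pdf_ge0.
  - by apply/measurable_EFinP; apply: measurable_funTS; exact: measurable_normal_pdf.
  - by move=> x _; rewrite lee_fin normal_pdf_ub.
rewrite integral_cst//= lebesgue_measure_itv/= lte_fin.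
case: ifPn => _; last first.
  by rewrite mule0 lee_fin mulr_ge0// divr_ge0 ?sqrtr_ge0// ltW.
rewrite -EFinB -EFinM lee_fin -normal_peakE// mulrnAl -mulrnAr.
by rewrite (_ : c + h - (c - h) = h *+ 2)//; ring.
Qed.

(** The Gaussian density is almost everywhere the Radon-Nikodym derivative. *)
Lemma ge0_integral_normal_prob m s (f : measurableTypeR R -> \bar R) :
  measurable_fun setT f -> (forall x, 0 <= f x)%E ->
  (\int[normal_prob m s]_x f x = \int[mu]_x (f x * (normal_pdf m s x)%:E))%E.
Proof.
move=> mf f0.
have nmu := normal_prob_dominates m s.
have gi := Radon_Nikodym_SigmaFinite.f_integrable nmu.
rewrite -(Radon_Nikodym_SigmaFinite.change_of_variables nmu)//.
have mpdf : measurable_fun setT (fun x => (normal_pdf m s x)%:E).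
  by apply/measurable_EFinP; exact: measurable_normal_pdf.
apply: ge0_ae_eq_integral => //.
- by apply: emeasurable_funM => //; exact: measurable_int gi.
- exact: emeasurable_funM.
- by move=> x _; rewrite mule_ge0// Radon_Nikodym_SigmaFinite.f_ge0.
- by move=> x _; rewrite mule_ge0// lee_fin normal_pdf_ge0.
apply: ae_eqe_mul2l; apply: integral_ae_eq => // E _ mE.
by rewrite -Radon_Nikodym_SigmaFinite.f_integral.
Qed.

(** An antiderivative of (x - m) times the density is - s ^ 2 times the density. *)
Lemma normal_upper_moment m s : 0 < s ->
  (\int[mu]_(x in `[m, +oo[) ((x - m) * normal_pdf m s x)%:E =
   (s ^+ 2 * normal_peak s)%:E)%E.
Proof.
move=> s0; have sn0 : s != 0 by rewrite gt_eqF.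
pose F : R -> R := fun x => - (s ^+ 2 * normal_peak s) * normal_fun m s x.
have dF x : is_derive x 1 F ((x - m) * normal_pdf m s x).
  pose g : R -> R := - (s ^+ 2 *+ 2)^-1 \*: (@id R - cst m) ^+ 2.
  have -> : F = - (s ^+ 2 * normal_peak s) \*: (expR \o g).
    apply/funext => y; rewrite /F /normal_fun /=; congr (_ * expR _).
    by rewrite /g /= exprfctE /= -[_ *: _]/(_ * _) !mulNr mulrC.
  have d1 : is_derive x 1 (@id R - cst m) (1 - 0) by apply: is_deriveB.
  have dg : is_derive x 1 g _ := is_deriveZ _ (is_deriveX 2 d1).
  have dF := is_deriveZ (- (s ^+ 2 * normal_peak s))
    (is_derive1_comp (is_derive_expR (g x)) dg).
  apply: (is_derive_eq dF).
  rewrite /= normal_pdfE// /normal_fun.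
  have -> : g x = - (x - m) ^+ 2 / (s ^+ 2 *+ 2).
    by rewrite /g /= exprfctE /= -[_ *: _]/(_ * _) !mulNr mulrC.
  rewrite subr0 /GRing.scale /= expr1 -[(id - cst m) x]/(x - m).
  move: (expR _) (normal_peak s) => e p.
  by field.
rewrite (@ge0_continuous_FTC2y _ _ F m 0).
- by rewrite /F /normal_fun subrr expr0n oppr0 mul0r expR0 mulr1 -EFinB sub0r opprK.
- by move=> x xm; rewrite mulr_ge0 ?normal_pdf_ge0// subr_ge0.
- apply: continuous_subspaceT => x; apply: cvgM.
    by apply: cvgB; [exact: cvg_id|exact: cvg_cst].
  exact: continuous_normal_pdf.
- rewrite -(mulr0 (- (s ^+ 2 * normal_peak s))); apply: cvgMr.
  have k0 : 0 < (s ^+ 2 *+ 2)^-1 by rewrite invr_gt0 pmulrn_lgt0// exprn_gt0.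
  rewrite /normal_fun; under eq_cvg do rewrite mulNr.
  apply: (cvg_comp (fun x : R => (x - m) ^+ 2 / (s ^+ 2 *+ 2))
    (fun x : R => expR (- x))); last exact: cvgr_expR.
  apply: gt0_cvgMly => //.
  apply: (cvg_comp (fun x : R => x - m) (fun x : R => x ^+ 2)).
    exact: cvg_addrr.
  exact: cvgr_expr2.
- by move=> x _; have [] := dF x.
- apply: cvg_at_right_filter; apply: differentiable_continuous.
  by apply/derivable1_diffP; have [] := dF m.
- by move=> x _; rewrite derive1E; exact: derive_val.
Qed.

Lemma normal_pdfN m s x : s != 0 ->
  normal_pdf m s (- x) = normal_pdf (- m) s x.
Proof.
move=> s0; rewrite !normal_pdfE// /normal_fun.
by have -> : (- x - m) ^+ 2 = (x - - m) ^+ 2 by ring.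
Qed.

Lemma sqrt_2pi_le1 : Num.sqrt (2 / pi) <= 1 :> R.
Proof.
rewrite -[leRHS]sqrtr1 ler_wsqrtr//.
by rewrite ler_pdivrMr ?pi_gt0// mul1r; exact: pi_ge2.
Qed.

(** The exact value is s * sqrt (2 / pi); the two half-lines contribute the same by the
    reflection x -> - x, which exchanges the means m and - m. *)
Lemma normal_abs_moment m s : 0 < s ->
  (\int[normal_prob m s]_x `|x - m|%:E <= s%:E)%E.
Proof.
move=> s0; have sn0 : s != 0 by rewrite gt_eqF.
have mabs (a : R) : measurable_fun setT (fun x : R => `|x - a|).
  by apply: measurableT_comp => //; exact: measurable_funB.
rewrite ge0_integral_normal_prob; [|by apply/measurable_EFinP; exact: mabs|by move=> x; rewrite lee_fin].
have mf (a : R) : measurable_fun setT (fun x => (`|x - a| * normal_pdf a s x)%:E).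
  apply/measurable_EFinP; apply: measurable_funM => //.
  exact: measurable_normal_pdf.
have right (a : R) : (\int[mu]_(x in `[a, +oo[) (`|x - a| * normal_pdf a s x)%:E =
   (s ^+ 2 * normal_peak s)%:E)%E.
  rewrite -(normal_upper_moment a s0); apply: eq_integral => x.
  by rewrite inE /= in_itv /= andbT => ax; rewrite ger0_norm// subr_ge0.
rewrite -(setUv `[m, +oo[%classic) ge0_integral_setU//=; last 4 first.
  exact: measurableC.
  by rewrite setUv; exact: mf.
  by move=> x _; rewrite mule_ge0// lee_fin normal_pdf_ge0.
  by apply/disj_setPCl.
rewrite setCitvr; under eq_integral do rewrite -EFinM.
rewrite right integral_itv_bndo_bndc; last by apply: measurable_funTS; exact: mf.
rewrite -{1}[m]opprK ge0_integration_by_substitutionNy.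
- have -> : (\int[mu]_(x in `[(- m)%R, +oo[)
      (((fun x => `|x - m| * normal_pdf m s x) \o -%R) x)%:E =
      \int[mu]_(x in `[(- m)%R, +oo[) (`|x - - m| * normal_pdf (- m) s x)%:E)%E.
    apply: eq_integral => x _; rewrite /= normal_pdfN// -normrN.
    congr (`|_| * _)%:E.
    by ring.
  rewrite right -EFinD lee_fin -mulrDr -mulr2n normal_peakE//.
  rewrite mulrCA expr2 mulrK ?unitfE// -[leRHS]mul1r.
  by rewrite ler_pM2r// sqrt_2pi_le1.
- apply: continuous_subspaceT => x; apply: cvgM.
    apply: cvg_norm; apply: cvgB; [exact: cvg_id|exact: cvg_cst].
  exact: continuous_normal_pdf.
- by move=> x _; rewrite mulr_ge0// normal_pdf_ge0.
Qed.

End normal_estimates.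

(** * Measurability of matrix functions *)

Section measurability.
Context {d : measure_display} {T : measurableType d} {R : realType}.

Lemma measurable_sum_cond (K : finType) (Q : pred K) (h : K -> T -> R) :
  (forall k, Q k -> measurable_fun setT (h k)) ->
  measurable_fun setT (fun w => \sum_(k | Q k) h k w).
Proof.
move=> mh; under eq_fun do rewrite big_mkcond.
apply: measurable_sum => k; case: (Q k) (@mh k) => [mhk|_]; first exact: mhk.
exact: measurable_cst.
Qed.

Lemma measurable_inv (f : T -> R) : measurable_fun setT f ->
  measurable_fun setT (fun w => (f w)^-1).
Proof.
move=> mf.
have -> : (fun w => (f w)^-1) = (fun w => if f w == 0 then 0 else (f w)^-1).
  by apply/funext => w; case: eqVneq => // ->; rewrite invr0.
apply: measurable_fun_if => //.
- exact: measurable_fun_eqr.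
- rewrite setTI.
  have minv : measurable_fun [set x : R | x != 0] (@GRing.inv R).
    apply: open_continuous_measurable_fun; first exact: open_neq.
    by move=> x; rewrite inE /=; exact: inv_continuous.
  apply: (measurable_comp _ _ minv) => //.
  + by apply: open_measurable; exact: open_neq.
  + by move=> _ [w /= fw0 <-]; rewrite fw0.
  + exact: measurable_funTS.
Qed.

Lemma measurable_ltr_set (f g : T -> R) :
  measurable_fun setT f -> measurable_fun setT g ->
  measurable [set w | f w < g w].
Proof.
move=> mf mg; rewrite -[X in measurable X]setTI.
exact: (measurable_fun_ltr mf mg measurableT (Y := [set true])).
Qed.

Lemma measurable_eqr_set (f g : T -> R) :
  measurable_fun setT f -> measurable_fun setT g ->
  measurable [set w | f w = g w].
Proof.
move=> mf mg; rewrite -[X in measurable X]setTI.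
have := measurable_fun_eqr mf mg measurableT (Y := [set true]).
have -> : (fun x => f x == g x) @^-1` [set true] = [set w | f w = g w].
  by apply/seteqP; split => w /= /eqP.
exact.
Qed.

Lemma measurable_lte_set (c : T -> \bar R) (t : R) : measurable_fun setT c ->
  measurable [set w | (t%:E < c w)%E].
Proof.
move=> mc; rewrite -[X in measurable X]setTI.
have mt : measurable_fun setT (cst t%:E : T -> \bar R) by exact: measurable_cst.
exact: (measurable_fun_lte mt mc measurableT (Y := [set true])).
Qed.

Lemma ge0_integral_sum_cond (mu : {measure set T -> \bar R}) (K : finType)
    (Q : pred K) (f : K -> T -> \bar R) :
  (forall k, measurable_fun setT (f k)) -> (forall k w, 0 <= f k w)%E ->
  (\int[mu]_w (\sum_(k | Q k) f k w) = \sum_(k | Q k) \int[mu]_w f k w)%E.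
Proof.
move=> mf f0; under eq_integral do rewrite -big_filter.
by rewrite ge0_integral_sum// big_filter.
Qed.

Lemma measurable_det n (M : T -> 'M[R]_n) :
  (forall i j, measurable_fun setT (fun w => M w i j)) ->
  measurable_fun setT (fun w => \det (M w)).
Proof.
move=> mM; rewrite /determinant; apply: measurable_sum => s.
by apply: measurable_funM => //; apply: measurable_prod => i _; exact: mM.
Qed.

Lemma measurable_cofactor n (M : T -> 'M[R]_n) i j :
  (forall k l, l != j -> measurable_fun setT (fun w => M w k l)) ->
  measurable_fun setT (fun w => cofactor (M w) i j).
Proof.
move=> mM; rewrite /cofactor; apply: measurable_funM => //.
apply: measurable_det => k l; under eq_fun do rewrite !mxE.
by apply: mM; rewrite eq_sym neq_lift.
Qed.

End measurability.

(** * Cancellation in one column *)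

Section gaussian_families.
Context {d : measure_display} {T : measurableType d} {R : realType}.
Variable P : probability T R.
Variables (I : finType) (X : I -> T -> R) (U : {set I}) (mean : I -> R) (s : R).

(** The zero entries of a sparse matrix are kept in the family, as the members outside U,
    so that dense and sparse columns are indexed alike. *)
Record gaussian_family : Prop := GaussianFamily {
  gfam_sd_gt0 : 0 < s;
  gfam_measurable : forall k, measurable_fun setT (X k);
  gfam_independent : forall B : I -> set R, (forall k, measurable (B k)) ->
    P (\bigcap_k (X k @^-1` B k)) = (\prod_k P (X k @^-1` B k))%E;
  gfam_law : forall k, k \in U -> forall B : set R, measurable B ->
    P (X k @^-1` B) = normal_prob (mean k) s B;
  gfam_mean : forall k, k \in U -> `|mean k| <= 1;
  gfam_off : forall k, k \notin U -> forall w, X k w = 0 }.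

Hypothesis gX : gaussian_family.
Let s0 : 0 < s := gfam_sd_gt0 gX.
Let mX := gfam_measurable gX.

(** Twice the maximum of the Gaussian density: an interval of half-length h has
    probability at most gauss_rate * h. *)
Definition gauss_rate := Num.sqrt (2 / pi) / s.

Lemma gauss_rate_ge0 : 0 <= gauss_rate.
Proof. by rewrite divr_ge0 ?sqrtr_ge0// ltW. Qed.

(** Given the other variables, X k is still Gaussian, and its density bounds the
    probability of the interval of centre c and half-length h. The weight p is kept
    inside the integral because the column bound averages over the choice of k. *)
Lemma gaussian_small_ball (J : {set I}) (k : I) (p c h : T -> R) :
  k \in U -> k \notin J -> adapted X J p -> adapted X J c -> adapted X J h ->
  (forall w, 0 <= p w) -> (forall w, 0 <= h w) ->
  (\int[P]_w (if `|X k w - c w| <= h w then p w else 0)%:E <=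
   \int[P]_w (gauss_rate * (p w * h w))%:E)%E.
Proof.
move=> kU kJ mp mc mh p0 h0.
pose f (z : g_sigma_algebraType (cylinders X J) * measurableTypeR R) : \bar R :=
  (if `|z.2 - c z.1| <= h z.1 then p z.1 else 0)%:E.
have mf : measurable_fun [set: _ * _] f.
  apply/measurable_EFinP; apply: measurable_fun_ifT => //.
  - apply: measurable_fun_ler; last exact: (measurableT_comp mh measurable_fst).
    apply: measurableT_comp => //; apply: measurable_funB => //.
    exact: (measurableT_comp mc measurable_fst).
  - exact: (measurableT_comp mp measurable_fst).
have f0 z : (0 <= f z)%E by rewrite /f lee_fin; case: ifP.
have := @ge0_integral_entry _ _ _ P I X mX (gfam_independent gX) J k
  (normal_prob (mean k) s) f kJ (gfam_law gX kU) mf f0.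
rewrite /f /= => ->.
apply: ge0_le_integral => //.
- by move=> w _; apply: integral_ge0 => x _; exact: (f0 (w, x)).
- have mF := measurable_fun_fubini_tonelli_F (m2 := normal_prob (mean k) s) f mf f0.
  exact: (measurableT_comp mF (@measurable_id_cylinders _ _ _ _ _ mX J)).
- apply/measurable_EFinP/measurable_funM; first exact: measurable_cst.
  by apply: measurable_funM; apply: (adapted_measurable mX); eassumption.
- move=> w _; pose B : set R := [set x | `|x - c w| <= h w].
  have mB : measurable B.
    have -> : B = `[c w - h w, c w + h w]%classic.
      by apply/seteqP; split => x; rewrite /B /= in_itv/= ler_distl.
    exact: measurable_itv.
  rewrite (eq_integral (fun x : measurableTypeR R => (p w)%:E * (\1_B x)%:E)%E); last first.
    move=> x _; rewrite indicE; case: ifPn => xB.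
      by rewrite mem_set// mule1.
    by rewrite memNset ?mule0//; exact/negP.
  rewrite ge0_integralZl_EFin//; last first.
    by apply/measurable_EFinP; exact: measurable_indic.
  rewrite integral_indic// setIT.
  apply: (@le_trans _ _ ((p w)%:E * (gauss_rate * h w)%:E)%E).
    by rewrite lee_wpmul2l ?lee_fin//; exact: normal_prob_ball.
  by rewrite -EFinM lee_fin mulrCA.
Qed.

Lemma gaussian_abs_moment (J : {set I}) (k : I) (p : T -> R) :
  k \in U -> k \notin J -> adapted X J p -> (forall w, 0 <= p w) ->
  (\int[P]_w (p w * `|X k w|)%:E <= (1 + s)%:E * \int[P]_w (p w)%:E)%E.
Proof.
move=> kU kJ mp p0.
pose f (z : g_sigma_algebraType (cylinders X J) * measurableTypeR R) : \bar R :=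
  (p z.1 * `|z.2|)%:E.
have mf : measurable_fun [set: _ * _] f.
  apply/measurable_EFinP; apply: measurable_funM => //.
    exact: (measurableT_comp mp measurable_fst).
  exact: measurableT_comp.
have f0 z : (0 <= f z)%E by rewrite lee_fin mulr_ge0.
have := @ge0_integral_entry _ _ _ P I X mX (gfam_independent gX) J k
  (normal_prob (mean k) s) f kJ (gfam_law gX kU) mf f0.
rewrite /f /= => ->.
have mpT : measurable_fun [set: T] p := adapted_measurable mX mp.
have s1 : 0 <= 1 + s by rewrite addr_ge0// ltW.
have mabs a : measurable_fun [set: measurableTypeR R]
    (fun x : R => `|x - a|%:E).
  apply/measurable_EFinP; apply: measurableT_comp; first exact: normr_measurable.
  exact: measurable_funB.
have mabs0 : measurable_fun [set: measurableTypeR R] (fun x : R => `|x|%:E).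
  by apply/measurable_EFinP; exact: normr_measurable.
rewrite -ge0_integralZl_EFin//; last first.
- exact/measurable_EFinP.
- by move=> w _; rewrite lee_fin.
apply: ge0_le_integral => //.
- by move=> w _; apply: integral_ge0 => x _; exact: (f0 (w, x)).
- have mF := measurable_fun_fubini_tonelli_F (m2 := normal_prob (mean k) s) f mf f0.
  exact: (measurableT_comp mF (@measurable_id_cylinders _ _ _ _ _ mX J)).
- apply/measurable_EFinP/measurable_funM => //; exact: measurable_cst.
- move=> w _; under eq_integral do rewrite EFinM.
  rewrite ge0_integralZl_EFin//.
  rewrite muleC lee_wpmul2r ?lee_fin//.
  apply: (@le_trans _ _ (\int[normal_prob (mean k) s]_x
      (cst 1 x + `|x - mean k|%:E))%E).
    apply: ge0_le_integral => //=.
    + by apply: emeasurable_funD; [exact: measurable_cst|exact: mabs].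
    + move=> x _; rewrite -EFinD lee_fin -[X in `|X|](subrK (mean k)).
      rewrite (le_trans (ler_normD _ _))// addrC lerD2r.
      exact: gfam_mean.
  rewrite ge0_integralD//=.
  rewrite integral_cst//= probability_setT mule1 EFinD leeD2l//.
  exact: normal_abs_moment.
Qed.

Section column.
Variables (K : finType) (e : K -> I) (g : K -> T -> R).
Hypothesis e_inj : injective e.
Hypothesis mg : forall i, adapted X [set k | k \notin codom e]%SET (g i).

Let J := [set k | k \notin codom e]%SET.
Let V := [set i | e i \in U]%SET.

(** A linear form in Gaussian variables X i, with coefficients g i that depend on other
    variables, is rarely much smaller than the sum of the absolute values of its terms.
    Solving for one X i, the event forces X i into an interval of half-length
    2 / (u - 1) * sum_(l != i) |X l| |g l / g i| whose centre does not depend on X i.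
    Averaging this over i with the weights p i = |g i| / sum |g l|, the ratios g l / g i
    become the weights p l, whose sum is 1: no bound on the coefficients is needed, and
    the result is linear in the number of variables. A single variable never
    produces the event, whence the predecessor. *)
Lemma column_sum_tail (u : R) : 1 < u ->
  (P [set w | (u * `|\sum_i X (e i) w * g i w| < \sum_i `|X (e i) w * g i w|)%R]
   <= (gauss_rate * (2 / (u - 1)) * (1 + s) * (#|V|.-1)%:R)%:E)%E.
Proof.
move=> u1; have u10 : 0 < u - 1 by rewrite subr_gt0.
have kap0 := gauss_rate_ge0.
set Z := [set w | _].
pose S w := \sum_(i in V) `|g i w|.
pose p i w := `|g i w| / S w.
pose c i w := - ((\sum_(l | l != i) X (e l) w * g l w) / g i w).
pose h i w := 2 / (u - 1) * (\sum_(l in V | l != i) `|X (e l) w| * `|g l w|) / `|g i w|.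
have S0 w : 0 <= S w by exact: sumr_ge0.
have p0 i w : 0 <= p i w by rewrite divr_ge0.
have h0 i w : 0 <= h i w.
  rewrite divr_ge0// mulr_ge0//; first by rewrite divr_ge0// ltW.
  by apply: sumr_ge0 => l _; rewrite mulr_ge0.
have mgT i : measurable_fun setT (g i) by exact: (adapted_measurable mX (@mg i)).
have nJ i : e i \notin J by rewrite inE negbK codom_f.
have mp i : adapted X J (p i).
  apply: measurable_funM.
    by apply: measurableT_comp => //; exact: mg.
  apply: measurable_inv; apply: measurable_sum_cond => l _.
  by apply: measurableT_comp => //; exact: mg.
have sJ i : J \subset [set~ e i]%SET.
  by apply/fintype.subsetP => k; rewrite !inE; apply: contra => /eqP ->; exact: codom_f.
have mg' i l : adapted X [set~ e i]%SET (g l) by exact: (adaptedS (sJ i) (@mg l)).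
have mp' i : adapted X [set~ e i]%SET (p i) by exact: (adaptedS (sJ i) (@mp i)).
have mX' i l : l != i -> adapted X [set~ e i]%SET (X (e l)).
  by move=> li; apply: adapted_entry; rewrite !inE (inj_eq e_inj).
have mc i : adapted X [set~ e i]%SET (c i).
  apply: measurableT_comp => //; apply: measurable_funM.
    apply: measurable_sum_cond => l li; apply: measurable_funM; last exact: mg'.
    exact: mX'.
  by apply: measurable_inv; exact: mg'.
have mh i : adapted X [set~ e i]%SET (h i).
  apply: measurable_funM; last first.
    by apply: measurable_inv; apply: measurableT_comp => //; exact: mg'.
  apply: measurable_funM; first exact: measurable_cst.
  apply: measurable_sum_cond => l /andP[_ li]; apply: measurable_funM.
    by apply: measurableT_comp => //; exact: mX'.
  by apply: measurableT_comp => //; exact: mg'.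
have iK i : e i \notin [set~ e i]%SET by rewrite !inE eqxx.
(* The event is dominated by its average over i; division by S w = 0 is harmless,
   since all the terms of the column vanish in this case. *)
have dom w : \1_Z w <=
    \sum_(i in V) if `|X (e i) w - c i w| <= h i w then p i w else 0.
  have sum0 : 0 <= \sum_(i in V) if `|X (e i) w - c i w| <= h i w then p i w else 0.
    by apply: sumr_ge0 => i _; case: ifP.
  have [Zw|nZw] := pselect (Z w); last by rewrite indicE memNset.
  rewrite indicE mem_set//=.
  have X0 i : i \notin V -> X (e i) w = 0.
    by rewrite inE => /(gfam_off gX).
  have Sgt0 : 0 < S w.
    rewrite lt0r S0 andbT; apply: contraPneq Zw => Sw0.
    have g0 i : i \in V -> g i w = 0.
      move=> iV; apply/eqP; rewrite -normr_eq0.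
      by move/eqP: Sw0; rewrite psumr_eq0// => /allP/(_ i); rewrite mem_index_enum iV => /(_ isT).
    apply/negP; rewrite -leNgt [leLHS]big1 ?mulr_ge0//; first by rewrite ltW// (lt_trans _ u1).
    move=> i _; have [/g0 ->|/X0 ->] := boolP (i \in V).
      by rewrite mulr0 normr0.
    by rewrite mul0r normr0.
  have -> : true%:R = \sum_(i in V) p i w.
    by rewrite /p -mulr_suml divff ?gt_eqF.
  apply: ler_sum => i iV; case: ifPn => // /negP far.
  have [gi0|gi0] := eqVneq (g i w) 0; first by rewrite /p gi0 normr0 mul0r.
  exfalso; apply: far.
  have gi : 0 < `|g i w| by rewrite normr_gt0.
  set Y := \sum_l X (e l) w * g l w in Zw.
  pose Q := \sum_(l in V | l != i) `|X (e l) w| * `|g l w|.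
  have QE : Q = \sum_(l | l != i) `|X (e l) w * g l w|.
    rewrite /Q [RHS](bigID (mem V))/= [X in _ = _ + X]big1 ?addr0.
      by apply: eq_big => l; [rewrite andbC|rewrite normrM].
    by move=> l /andP[_ /X0 ->]; rewrite mul0r normr0.
  have -> : X (e i) w - c i w = Y / g i w.
    by rewrite /c opprK /Y [in RHS](bigD1 i)//= mulrDl mulfK.
  rewrite /h -/Q normrM normfV ler_pM2r ?invr_gt0// mulrAC ler_pdivlMr//.
  have W1 : \sum_l `|X (e l) w * g l w| = `|X (e i) w * g i w| + Q.
    by rewrite QE (bigD1 i).
  have W2 : `|X (e i) w * g i w| <= `|Y| + Q.
    have -> : X (e i) w * g i w = Y - \sum_(l | l != i) X (e l) w * g l w.
      by rewrite /Y [in RHS](bigD1 i)//= addrK.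
    by rewrite (le_trans (ler_normB _ _))// lerD2l QE ler_norm_sum.
  by move: Zw; rewrite /Z /= W1; lra.
(* Multiplying by p i replaces the ratios g l / g i by the weights p l. *)
have php i w : p i w * h i w <=
    2 / (u - 1) * \sum_(l in V | l != i) p l w * `|X (e l) w|.
  have -> : \sum_(l in V | l != i) p l w * `|X (e l) w| =
      (\sum_(l in V | l != i) `|X (e l) w| * `|g l w|) / S w.
    by rewrite mulr_suml; apply: eq_bigr => l _; rewrite /p mulrAC [X in X / _]mulrC.
  rewrite /h; set Q := \sum_(l in V | _) _.
  have Q0 : 0 <= Q by apply: sumr_ge0 => l _; rewrite mulr_ge0.
  have [gi0|gi0] := eqVneq (g i w) 0.
    by rewrite /p gi0 normr0 !mul0r mulr_ge0 ?divr_ge0// ltW.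
  rewrite /p; move: (S w)^-1 => Si.
  rewrite le_eqVlt; apply/orP; left; apply/eqP; field.
  by rewrite normr_eq0 gi0 gt_eqF.
have mXg i : measurable_fun setT (fun w => X (e i) w * g i w).
  by apply: measurable_funM => //; exact: mX.
have mZ : measurable Z.
  apply: measurable_ltr_set.
    apply: measurable_funM; first exact: measurable_cst.
    by apply: measurableT_comp => //; exact: measurable_sum_cond.
  by apply: measurable_sum_cond => i _; exact: measurableT_comp.
have mpT i : measurable_fun setT (p i) by exact: (adapted_measurable mX (@mp i)).
have mhT i : measurable_fun setT (h i) by exact: (adapted_measurable mX (@mh i)).
have mcT i : measurable_fun setT (c i) by exact: (adapted_measurable mX (@mc i)).
pose a := 2 / (u - 1) * gauss_rate.
have a0 : 0 <= a by rewrite mulr_ge0// divr_ge0// ltW.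
have mA i : measurable_fun setT
    (fun w => if `|X (e i) w - c i w| <= h i w then p i w else 0).
  apply: measurable_fun_ifT => //; apply: measurable_fun_ler => //.
  by apply: measurableT_comp => //; apply: measurable_funB => //; exact: mX.
rewrite -(setIT Z) -integral_indic//.
apply: (@le_trans _ _ (\int[P]_w (\sum_(i in V)
    (if `|X (e i) w - c i w| <= h i w then p i w else 0)%:E))%E).
  apply: ge0_le_integral => //.
  - by apply/measurable_EFinP; exact: measurable_indic.
  - under eq_fun do rewrite sumEFin.
    by apply/measurable_EFinP; apply: measurable_sum_cond => i _; exact: mA.
  - by move=> w _; rewrite sumEFin lee_fin; exact: dom.
rewrite ge0_integral_sum_cond; last 2 first.
- by move=> i; apply/measurable_EFinP.
- by move=> i w; rewrite lee_fin; case: ifP.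
have pX0 l w : 0 <= p l w * `|X (e l) w| by rewrite mulr_ge0.
have mpX l : measurable_fun setT (fun w => p l w * `|X (e l) w|).
  by apply: measurable_funM => //; apply: measurableT_comp => //; exact: mX.
have int1 i : i \in V ->
    (\int[P]_w (if `|X (e i) w - c i w| <= h i w then p i w else 0)%:E <=
     a%:E * \sum_(l in V | l != i) (1 + s)%:E * \int[P]_w (p l w)%:E)%E.
  rewrite inE => iV.
  apply: (le_trans (gaussian_small_ball iV (iK i) (mp' i) (mc i) (mh i) (p0 i) (h0 i))).
  apply: (@le_trans _ _ (\int[P]_w (a%:E *
      \sum_(l in V | l != i) (p l w * `|X (e l) w|)%:E))%E).
    apply: ge0_le_integral => //.
    - by move=> w _; rewrite lee_fin mulr_ge0// mulr_ge0.
    - apply/measurable_EFinP; apply: measurable_funM; first exact: measurable_cst.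
      exact: measurable_funM.
    - under eq_fun do rewrite sumEFin -EFinM.
      apply/measurable_EFinP; apply: measurable_funM; first exact: measurable_cst.
      by apply: measurable_sum_cond => l _.
    - move=> w _; rewrite sumEFin -EFinM lee_fin [a]mulrC -[leRHS]mulrA.
      by rewrite ler_wpM2l.
  rewrite ge0_integralZl_EFin//; last 2 first.
  - by move=> w _; rewrite sumEFin lee_fin; apply: sumr_ge0.
  - under eq_fun do rewrite sumEFin.
    by apply/measurable_EFinP; apply: measurable_sum_cond => l _.
  rewrite lee_wpmul2l ?lee_fin// ge0_integral_sum_cond; last 2 first.
  - by move=> l; apply/measurable_EFinP.
  - by move=> l w; rewrite lee_fin.
  apply: lee_sum => l /andP[]; rewrite inE => lV _.
  exact: (gaussian_abs_moment lV (nJ l) (@mp l) (p0 l)).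
pose q l := fine (\int[P]_w (p l w)%:E)%E.
have S1 w : \sum_(l in V) p l w <= 1.
  rewrite /p -mulr_suml; have [->|Sw] := eqVneq (S w) 0; first by rewrite invr0 mulr0.
  by rewrite divff.
have sumq1 : (\sum_(l in V) \int[P]_w (p l w)%:E <= 1)%E.
  rewrite -ge0_integral_sum_cond; last 2 first.
  - by move=> l; apply/measurable_EFinP.
  - by move=> l w; rewrite lee_fin.
  apply: (@le_trans _ _ (\int[P]_w (cst 1 w))%E).
    apply: ge0_le_integral => //.
    - by move=> w _; apply: sume_ge0 => l _; rewrite lee_fin.
    - under eq_fun do rewrite sumEFin.
      by apply/measurable_EFinP; apply: measurable_sum_cond => l _.
    - by move=> w _; rewrite sumEFin lee_fin.
  by rewrite integral_cst//= probability_setT mule1.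
have qE l : l \in V -> (\int[P]_w (p l w)%:E)%E = (q l)%:E.
  move=> lV; rewrite /q fineK// ge0_fin_numE; last first.
    by apply: integral_ge0 => w _; rewrite lee_fin.
  apply: (@le_lt_trans _ _ 1%E); last exact: ltry.
  apply: le_trans sumq1; rewrite (bigD1 l)//= leeDl// sume_ge0// => k _.
  by apply: integral_ge0 => w _; rewrite lee_fin.
have sq1 : \sum_(l in V) q l <= 1.
  by rewrite -lee_fin -sumEFin (le_trans _ sumq1)// lee_sum// => l lV; rewrite qE.
apply: (@le_trans _ _ (\sum_(i in V) (a * \sum_(l in V | l != i) (1 + s) * q l)%:E)%E).
  apply: lee_sum => i iV; rewrite (le_trans (int1 i iV))// [leRHS]EFinM -[in leRHS]sumEFin.
  rewrite lee_wpmul2l ?lee_fin// lee_sum// => l /andP[lV _].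
  by rewrite qE.
rewrite sumEFin lee_fin -mulr_sumr.
have -> : \sum_(i in V) \sum_(l in V | l != i) (1 + s) * q l =
    (1 + s) * (#|V|.-1%:R * \sum_(l in V) q l).
  rewrite (exchange_big_dep (mem V))/=; last by move=> i l _ /andP[].
  rewrite !mulr_sumr; apply: eq_bigr => l lV.
  rewrite (eq_bigl (fun i => i \in V :\ l)%SET); last first.
    by move=> i; rewrite in_setD1 lV /= eq_sym andbC.
  by rewrite sumr_const (cardsD1 l V) lV add1n mulrCA mulr_natl.
have s1 : 0 <= 1 + s by rewrite addr_ge0// ltW.
rewrite /a [leRHS](_ : _ = 2 / (u - 1) * gauss_rate * ((1 + s) * (#|V|.-1%:R * 1))).
  by rewrite ler_wpM2l// ler_wpM2l// ler_wpM2l.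
by ring.
Qed.

End column.

End gaussian_families.

(** * Almost sure invertibility *)

Section nonsingularity.
Context {d : measure_display} {T : measurableType d} {R : realType}.
Variable P : probability T R.
Variables (I : finType) (X : I -> T -> R) (U : {set I}) (mean : I -> R) (s : R).
Hypothesis gX : gaussian_family P X U mean s.
Let mX := gfam_measurable gX.

(** The small ball bound with half-length 0. *)
Lemma gaussian_graph_negligible (J : {set I}) (k : I) (c : T -> R) :
  k \in U -> k \notin J -> adapted X J c ->
  P.-negligible [set w | X k w = c w].
Proof.
move=> kU kJ mc; set N := [set w | _].
have mcT : measurable_fun setT c := adapted_measurable mX mc.
have mN : measurable N by exact: measurable_eqr_set.
exists N; split => //; apply/eqP; rewrite eq_le measure_ge0 andbT.
have := @gaussian_small_ball _ _ _ P I X U mean s gX J k (cst 1) c (cst 0) kU kJ.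
have mcst r : adapted X J (cst r) by exact: measurable_cst.
move=> /(_ (mcst _) mc (mcst _) (fun _ => ler01) (fun _ => lexx _)).
rewrite [X in (_ <= X)%E -> _]integral0_eq; last by move=> w _; rewrite /= !mulr0.
apply: le_trans; rewrite -(setIT N) -integral_indic//.
apply: ge0_le_integral => //.
- by apply/measurable_EFinP; exact: measurable_indic.
- apply/measurable_EFinP; apply: measurable_fun_ifT => //.
  apply: measurable_fun_ler => //.
  by apply: measurableT_comp => //; exact: measurable_funB.
- move=> w _; rewrite lee_fin indicE; have [Nw|nNw] := pselect (N w).
    by rewrite mem_set// Nw subrr normr0 lexx.
  by rewrite memNset//; case: ifP.
Qed.

Variables (n : nat) (e : 'I_n * 'I_n -> I) (M0 : 'M[R]_n).
Hypothesis e_inj : injective e.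
Hypothesis M0unit : M0 \in unitmx.
Hypothesis M0supp : forall x, e x \notin U -> M0 x.1 x.2 = 0.

Let H (r : seq ('I_n * 'I_n)) w : 'M[R]_n :=
  \matrix_(i, j) if (i, j) \in r then X (e (i, j)) w else M0 i j.

(** The entries of the invertible matrix M0 are replaced by random ones, one at a time.
    The determinant is affine in the new entry, and it was nonzero before the
    replacement: if it vanishes afterwards, then its slope is nonzero and the new entry
    takes a value determined by the other ones. *)
Lemma gaussian_singular_negligible :
  P.-negligible [set w | \det (\matrix_(i, j) X (e (i, j)) w) = 0].
Proof.
suff HN r : P.-negligible [set w | \det (H r w) = 0].
  apply: negligibleS (HN (enum {: 'I_n * 'I_n})) => w /= <-; congr (\det _).
  by apply/matrixP => i j; rewrite !mxE mem_enum.
elim: r => [|x r IHr].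
  rewrite [X in _ .-negligible X](_ : _ = set0); first exact: negligible_set0.
  apply/seteqP; split => w //=.
  have -> : H [::] w = M0 by apply/matrixP => i j; rewrite !mxE.
  by apply/eqP; rewrite -unitfE -unitmxE.
have [xr|xr] := boolP (x \in r).
  apply: negligibleS IHr => w /= <-; congr (\det _); apply/matrixP => i j.
  by rewrite !mxE in_cons; case: eqVneq => // ->; rewrite xr.
have [xU|xU] := boolP (e x \in U); last first.
  apply: negligibleS IHr => w /= <-; congr (\det _); apply/matrixP => i j.
  rewrite !mxE in_cons; case: eqVneq => //= xE.
  by rewrite xE (negbTE xr) (gfam_off gX xU) -(M0supp xU) -xE.
(* The only value of entry x that makes the new determinant vanish. *)
pose c w := M0 x.1 x.2 - \det (H r w) / cofactor (H r w) x.1 x.2.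
have mH i j : adapted X [set~ e x]%SET (fun w => H r w i j).
  under eq_fun do rewrite mxE.
  have [ijr|_] := boolP ((i, j) \in r); last exact: measurable_cst.
  apply: adapted_entry; rewrite !inE (inj_eq e_inj).
  by apply: contraNneq xr => <-.
have mc : adapted X [set~ e x]%SET c.
  apply: measurable_funB; first exact: measurable_cst.
  apply: measurable_funM; first exact: measurable_det.
  by apply: measurable_inv; apply: measurable_cofactor => k l _; exact: mH.
have nx : e x \notin [set~ e x]%SET by rewrite !inE eqxx.
apply: negligibleS (negligibleU IHr (gaussian_graph_negligible xU nx mc)).
move=> w /= dxr.
have detE : \det (H (x :: r) w) = \det (H r w) +
    (X (e x) w - M0 x.1 x.2) * cofactor (H r w) x.1 x.2.
  have cofE i : cofactor (H (x :: r) w) i x.2 = cofactor (H r w) i x.2.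
    rewrite /cofactor; congr (_ * \det _); apply/matrixP => k l.
    rewrite !mxE in_cons; case: eqVneq => // xE.
    by have := neq_lift x.2 l; have /= -> := congr1 snd xE; rewrite eqxx.
  rewrite [LHS](expand_det_col _ x.2) [\det (H r w)](expand_det_col _ x.2).
  rewrite [LHS](bigD1 x.1)//= [X in _ = X + _](bigD1 x.1)//= cofE addrAC.
  congr (_ + _).
    rewrite !mxE -surjective_pairing in_cons eqxx /= (negbTE xr).
    by rewrite -mulrDl addrC subrK.
  apply: eq_bigr => i ix; rewrite cofE !mxE in_cons; case: eqVneq => // xE.
  by move: ix; have /= -> := congr1 fst xE; rewrite eqxx.
have [?|dr] := eqVneq (\det (H r w)) 0; [by left|right].
have cof0 : cofactor (H r w) x.1 x.2 != 0.
  apply: contraNneq dr => cof0; move: dxr; rewrite detE cof0 mulr0 addr0.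
  by move=> ->.
apply: (mulIf cof0); rewrite /c mulrBl divfK//.
by move: dxr; rewrite detE mulrBl => /eqP; lra.
Qed.

End nonsingularity.

(** * The random system as one independent family *)

Section random_system.
Context {d : measure_display} {T : measurableType d} {R : realType}.
Variable P : probability T R.

(** Constant entries are independent of everything, so that the product rule on S
    extends to all the entries. *)
Lemma gaussian_mx_independent (m n : nat) (S : {set 'I_m * 'I_n})
    (Abar : 'M[R]_(m, n)) (s : R) (A : T -> 'M[R]_(m, n))
    (B : 'I_m * 'I_n -> set R) :
  gaussian_mx P S Abar s A -> (forall k, measurable (B k)) ->
  P (\bigcap_k (entry A k @^-1` B k)) = (\prod_k P (entry A k @^-1` B k))%E.
Proof.
case=> mA _ indA suppA mB.
have A0 k w : k \notin S -> entry A k w = 0.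
  by move=> kS; apply: suppA; rewrite -surjective_pairing.
have [[k kS B0]|B0] := pselect (exists2 k, k \notin S & ~ B k 0).
  have pre0 : entry A k @^-1` B k = set0.
    by apply/seteqP; split => w //=; rewrite A0.
  rewrite (bigD1 k)//= pre0 measure0 mul0e.
  rewrite (_ : \bigcap_k _ = set0) ?measure0//.
  by apply/seteqP; split => w // /(_ k Logic.I); rewrite pre0.
have preT k : k \notin S -> entry A k @^-1` B k = setT.
  move=> kS; apply/seteqP; split => w //= _; rewrite A0//.
  by apply: contrapT => nB; apply: B0; exists k.
rewrite (bigID (mem S))/= [X in (_ * X)%E]big1 ?mule1; last first.
  by move=> k kS; rewrite preT// probability_setT.
rewrite -indA//; congr (P _); apply/seteqP; split => w H k.
  by move=> _; exact: H.
by have [/H//|kS] := boolP (k \in S); rewrite preT.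
Qed.

(** This is the form in which the independence of A and b is used. *)
Lemma bigcap_entry_sigma_mx (m n : nat) (A : T -> 'M[R]_(m, n))
    (B : 'I_m * 'I_n -> set R) : (forall k, measurable (B k)) ->
  sigma_mx A (\bigcap_k (entry A k @^-1` B k)).
Proof.
move=> mB; apply: (@fin_bigcap_measurable _ (g_sigma_algebraType _)) => //.
by move=> k _; apply: sub_sigma_algebra; exists k; exists (B k).
Qed.

Variables (n : nat) (S : {set 'I_n * 'I_n}) (Abar : 'M[R]_n) (bbar : 'cV[R]_n).
Variables (s : R) (A : T -> 'M[R]_n) (b : T -> 'cV[R]_n).

Definition system_entry (k : 'I_n * 'I_n + 'I_n * 'I_1) : T -> R :=
  match k with inl p => entry A p | inr q => entry b q end.

Definition system_support : {set 'I_n * 'I_n + 'I_n * 'I_1} :=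
  [set k | if k is inl p then p \in S else true].

Definition system_mean (k : 'I_n * 'I_n + 'I_n * 'I_1) : R :=
  match k with inl p => Abar p.1 p.2 | inr q => bbar q.1 q.2 end.

Lemma system_gaussian_family : 0 < s -> `|Abar| <= 1 -> `|bbar| <= 1 ->
  gaussian_mx P S Abar s A -> gaussian_mx P [set: 'I_n * 'I_1]%SET bbar s b ->
  independent_mx P A b ->
  gaussian_family P system_entry system_support system_mean s.
Proof.
move=> s0 A1 b1 gA gb indAb.
have [mA lawA _ suppA] := gA; have [mb lawb _ _] := gb.
split => //.
- by case=> k; [exact: mA|exact: mb].
- move=> B mB; rewrite big_sumType /=.
  rewrite -(gaussian_mx_independent gA (fun k => mB (inl k))).
  rewrite -(gaussian_mx_independent gb (fun k => mB (inr k))).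
  rewrite -indAb; last 2 first.
  + by apply: (@bigcap_entry_sigma_mx _ _ A (fun k => B (inl k))).
  + by apply: (@bigcap_entry_sigma_mx _ _ b (fun k => B (inr k))).
  congr (P _); apply/seteqP; split => w.
    by move=> H; split => k _; [exact: (H (inl k))|exact: (H (inr k))].
  by move=> [HA Hb] [k|k] _; [exact: HA|exact: Hb].
- case=> k; rewrite inE => kS B mB /=; [exact: lawA|].
  by apply: lawb => //; rewrite inE.
- case=> k _ /=; rewrite (le_trans (le_entry_mx_norm _ _ _))//.
- case=> k; rewrite inE// => kS w; apply: suppA.
  by rewrite -surjective_pairing.
Qed.

End random_system.

(** * Measurability of the condition number *)

Section measurable_condition.
Context {d : measure_display} {T : measurableType d} {R : realType}.

Lemma measurable_setsystem_valued (K : finType) (f : T -> {set K})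
    (Q : {set K} -> Prop) :
  (forall i, measurable [set w | i \in f w]) -> measurable [set w | Q (f w)].
Proof.
move=> mf.
have -> : [set w | Q (f w)] = \bigcup_(Z in [set Z | Q Z])
    \bigcap_i (if i \in Z then [set w | i \in f w] else ~` [set w | i \in f w]).
  apply/seteqP; split => [w Qw|w [Z QZ HZ]].
    by exists (f w) => // i _; case: ifPn => // /negP.
  rewrite /= (_ : f w = Z)//; apply/setP => i; have := HZ i Logic.I.
  by case: ifPn => /= [_ -> //|_ /negP/negbTE].
apply: fin_bigcup_measurable; first exact: finite_finset.
move=> Z _; apply: fin_bigcap_measurable; first exact: finite_finset.
by move=> i _; case: ifP => _ //; exact: measurableC.
Qed.

Lemma measurable_bigmaxe (K : finType) (f : K -> T -> \bar R) (x0 : \bar R) :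
  (forall k, measurable_fun setT (f k)) ->
  measurable_fun setT (fun w => \big[maxe/x0]_k f k w).
Proof.
move=> mf; elim: (index_enum K) => [|k r IHr].
  by under eq_fun do rewrite big_nil; exact: measurable_cst.
by under eq_fun do rewrite big_cons; exact: measurable_maxe.
Qed.

Variables (n : nat) (A : T -> 'M[R]_n) (b : T -> 'cV[R]_n).
Hypothesis mA : forall i j, measurable_fun setT (fun w => A w i j).
Hypothesis mb : forall i, measurable_fun setT (fun w => b w i ord0).

Let mdet : measurable_fun setT (fun w => \det (A w)).
Proof. exact: measurable_det. Qed.

Let minv k i : measurable_fun setT (fun w => inv_entry (A w) k i).
Proof.
by apply: measurable_funM; [exact: measurable_inv|exact: measurable_cofactor].
Qed.

Let msol k : measurable_fun setT (fun w => sol_entry (A w) (b w) k).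
Proof. by apply: measurable_sum => i; exact: measurable_funM. Qed.

Let mskeel k : measurable_fun setT (fun w => skeel (A w) (b w) k).
Proof.
apply: measurable_funM; last by apply: measurable_inv; exact: measurableT_comp.
apply: measurable_sum => i; apply: measurable_funM; first exact: measurableT_comp.
apply: measurable_funD; first exact: measurableT_comp.
by apply: measurable_sum => j; apply: measurable_funM; exact: measurableT_comp.
Qed.

(** The probability is meaningful only on measurable sets, so that the condition
    number has to be known everywhere, including on the null events where A is singular
    or x_k = 0. *)
Lemma measurable_cond_lin : measurable_fun setT (fun w => cond_lin (A w) (b w)).
Proof.
pose Z w : {set 'I_(n * n + n)} := [set i | pack (A w) (b w) ord0 i == 0]%SET.
pose G k w : \bar R := if sol_entry (A w) (b w) k == 0 then
  (if `[< vanishing (R := R) k (Z w) >] then 0%E else +oo%E) else (skeel (A w) (b w) k)%:E.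
have -> : (fun w => cond_lin (A w) (b w)) =
    fun w => if \det (A w) == 0 then +oo%E else \big[maxe/-oo%E]_k G k w.
  apply/funext => w; rewrite /cond_lin unitmxE unitfE.
  case: eqVneq => //= dA; apply: eq_bigr => k _.
  have Au : A w \in unitmx by rewrite unitmxE unitfE.
  rewrite /G; case: eqVneq => xk; last exact: cond_lin_k_regular.
  case: asboolP => V; first exact: cond_lin_k_vanishing.
  exact: cond_lin_k_nonvanishing.
apply: measurable_fun_ifT; [exact: measurable_fun_eqr|exact: measurable_cst|].
apply: measurable_bigmaxe => k; apply: measurable_fun_ifT.
- exact: measurable_fun_eqr.
- apply: measurable_fun_ifT; [|exact: measurable_cst|exact: measurable_cst].
  apply: (measurable_fun_bool true); rewrite setTI.
  have -> : (fun w => `[< vanishing (R := R) k (Z w) >]) @^-1` [set true] =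
      [set w | vanishing (R := R) k (Z w)].
    by apply/seteqP; split => w /= H; [exact: asboolW|exact: asboolT].
  apply: measurable_setsystem_valued => c; rewrite /Z.
  have -> : [set w | c \in [set i | pack (A w) (b w) ord0 i == 0]%SET] =
      [set w | pack (A w) (b w) ord0 c = 0].
    by apply/seteqP; split => w /=; rewrite inE => /eqP.
  apply: measurable_eqr_set; last exact: measurable_cst.
  have [[i [j ->]]|[i ->]] := coordP c.
    by under eq_fun do rewrite -unpack_mxE unpack_mx_pack; exact: mA.
  by under eq_fun do rewrite -unpack_rhsE unpack_rhs_pack; exact: mb.
- exact/measurable_EFinP.
Qed.

End measurable_condition.

Section covering.
Context {d : measure_display} {T : measurableType d} {R : realType}.
Variable P : probability T R.

(** An upper bound on the outer measure: bad events can be collected without a proof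
    that each of them is measurable. *)
Definition covered (E : set T) (x : R) : Prop :=
  exists B, [/\ measurable B, E `<=` B & (P B <= x%:E)%E].

Lemma coveredS E F x : E `<=` F -> covered F x -> covered E x.
Proof. by move=> EF [B [mB FB Bx]]; exists B; split => //; exact: subset_trans FB. Qed.

Lemma covered_measurable E x : measurable E -> covered E x -> (P E <= x%:E)%E.
Proof.
by move=> mE [B [mB EB]]; apply: le_trans; apply: le_measure; rewrite ?inE.
Qed.

Lemma negligible_covered E : P.-negligible E -> covered E 0.
Proof. by move=> [B [mB B0 EB]]; exists B; rewrite B0. Qed.

Lemma coveredU E F x y : covered E x -> covered F y -> covered (E `|` F) (x + y).
Proof.
move=> [B [mB EB Bx]] [C [mC FC Cy]]; exists (B `|` C).
split; [exact: measurableU|exact: setUSS|].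
by rewrite (le_trans (measureU2 _ mB mC))// EFinD leeD.
Qed.

Lemma covered_exists (K : finType) (E : K -> set T) (x : K -> R) :
  (forall k, covered (E k) (x k)) ->
  covered [set w | exists k, E k w] (\sum_k x k).
Proof.
move=> cE.
suff H (r : seq K) : covered [set w | exists2 k, k \in r & E k w] (\sum_(k <- r) x k).
  by apply: coveredS (H (index_enum K)) => w [k Ek]; exists k => //; rewrite mem_index_enum.
elim: r => [|k r IHr].
  by rewrite big_nil; exists set0; split => //; rewrite ?measure0// => w [].
rewrite big_cons; apply: coveredS (coveredU (cE k) IHr).
move=> w [l]; rewrite in_cons => /orP[/eqP -> Ek|lr El]; first by left.
by right; exists l.
Qed.

End covering.

(** * Tail of the condition number *)

Section random_matrix_columns.
Context {d : measure_display} {T : measurableType d} {R : realType}.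
Variable P : probability T R.
Variables (I : finType) (X : I -> T -> R) (U : {set I}) (mean : I -> R) (s : R).
Hypothesis gX : gaussian_family P X U mean s.
Variables (n : nat) (e : 'I_n * 'I_n -> I).
Hypothesis e_inj : injective e.

Let M w : 'M[R]_n := \matrix_(i, j) X (e (i, j)) w.

(** Expansion along column j: the cofactors do not involve the entries of that column. *)
Lemma cofactor_column_tail (j : 'I_n) (u : R) : 1 < u ->
  covered P [set w | u * `|\det (M w)| < \sum_i `|M w i j * cofactor (M w) i j|]
    (gauss_rate s * (2 / (u - 1)) * (1 + s) *
     (#|[set i | e (i, j) \in U]%SET|.-1)%:R).
Proof.
move=> u1.
have mM i l : measurable_fun setT (fun w => M w i l).
  by under eq_fun do rewrite mxE; exact: gfam_measurable gX _.
have ej_inj : injective (fun i => e (i, j)) by move=> i i' /e_inj[].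
have mg i : adapted X [set k | k \notin codom (fun i => e (i, j))]%SET
    (fun w => cofactor (M w) i j).
  apply: measurable_cofactor => k l lj /=.
  have -> : (fun w => M w k l) = X (e (k, l)) by apply/funext => w; rewrite mxE.
  apply: adapted_entry; rewrite inE; apply/codomP => -[i' /e_inj[_ lj']].
  by rewrite lj' eqxx in lj.
exists [set w | u * `|\det (M w)| < \sum_i `|M w i j * cofactor (M w) i j|].
split => //.
  apply: measurable_ltr_set.
    apply: measurable_funM; first exact: measurable_cst.
    by apply: measurableT_comp => //; exact: measurable_det.
  apply: measurable_sum => i; apply: measurableT_comp => //.
  by apply: measurable_funM => //; exact: measurable_cofactor.
apply: le_trans (column_sum_tail gX ej_inj mg u1).
rewrite le_eqVlt; apply/orP; left; apply/eqP; congr (P _).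
have EW w : \sum_i `|X (e (i, j)) w * cofactor (M w) i j| =
    \sum_i `|M w i j * cofactor (M w) i j|.
  by apply: eq_bigr => i _; rewrite [M w i j]mxE.
have ED w : \sum_i X (e (i, j)) w * cofactor (M w) i j = \det (M w).
  by rewrite (expand_det_col _ j); apply: eq_bigr => i _; rewrite [M w i j]mxE.
by apply/seteqP; split => w /=; rewrite EW ED.
Qed.

End random_matrix_columns.

Section condition_tail.
Context {d : measure_display} {T : measurableType d} {R : realType}.
Variable P : probability T R.
Variables (n : nat) (S : {set 'I_n * 'I_n}) (Abar : 'M[R]_n) (bbar : 'cV[R]_n).
Variables (s : R) (A : T -> 'M[R]_n) (b : T -> 'cV[R]_n).
Hypothesis n_gt0 : (0 < n)%N.
Hypothesis admS : admissible R S.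
Hypothesis gX : gaussian_family P (system_entry A b) (system_support S)
  (system_mean Abar bbar) s.

Let col_size j := #|[set i | (i, j) \in S]%SET|.

Let sum_col_size : (\sum_j col_size j)%N = #|S|.
Proof.
rewrite -sum1_card (eq_bigl (fun p => (p.1, p.2) \in S)); last by case.
rewrite -(pair_big_dep xpredT (fun i j => (i, j) \in S) (fun _ _ => 1%N)) /=.
rewrite (exchange_big_dep xpredT)//=; apply: eq_bigr => j _.
by rewrite sum1dep_card.
Qed.

Let col_size_gt0 j : (0 < col_size j)%N.
Proof.
have [A0 [suppA0 A0u]] := admS.
rewrite card_gt0; apply/set0Pn.
have [i Aij|A0j] := pickP (fun i => A0 i j != 0).
  by exists i; rewrite inE; apply: contraNT Aij => /suppA0 ->.
have : \det A0 = 0.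
  rewrite (expand_det_col _ j) big1// => i _.
  by have /negbFE/eqP -> := A0j i; rewrite mul0r.
by move/eqP; rewrite -[_ == _]negbK -unitfE -unitmxE A0u.
Qed.

Lemma admissible_card_ge : (n <= #|S|)%N.
Proof.
rewrite -sum_col_size -[leqLHS]card_ord -sum1_card.
by apply: leq_sum => j _; exact: col_size_gt0.
Qed.

(** Both A and the matrices M_k of Cramer's rule, in which b replaces column k of A, have
    distinct members of one independent family as entries; idxA and idxM k locate them. *)
Let idxA (p : 'I_n * 'I_n) : 'I_n * 'I_n + 'I_n * 'I_1 := inl p.

Let idxM k (p : 'I_n * 'I_n) : 'I_n * 'I_n + 'I_n * 'I_1 :=
  if p.2 == k then inr (p.1, ord0) else inl p.

Let idxA_inj : injective idxA. Proof. by move=> p q []. Qed.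

Let idxM_inj k : injective (idxM k).
Proof.
move=> [i j] [i' j']; rewrite /idxM /=.
by case: eqVneq => [->|_]; case: eqVneq => [->|_] // [-> //] ->.
Qed.

Let idxAE w : \matrix_(i, j) system_entry A b (idxA (i, j)) w = A w.
Proof. by apply/matrixP => i j; rewrite mxE. Qed.

Let idxME k w : \matrix_(i, j) system_entry A b (idxM k (i, j)) w =
  replace_col (A w) (b w) k.
Proof. by apply/matrixP => i j; rewrite !mxE /idxM /=; case: ifP. Qed.

Let singularA : P.-negligible [set w | \det (A w) = 0].
Proof.
have [A0 [suppA0 A0u]] := admS.
have supp x : idxA x \notin system_support S -> A0 x.1 x.2 = 0.
  by rewrite inE => xS; apply: suppA0; rewrite -surjective_pairing.
apply: negligibleS (gaussian_singular_negligible gX idxA_inj A0u supp) => w /=.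
by rewrite idxAE.
Qed.

Let singularM k : P.-negligible [set w | \det (replace_col (A w) (b w) k) = 0].
Proof.
have [A0 [suppA0 A0u]] := admS.
have supp x : idxM k x \notin system_support S -> A0 x.1 x.2 = 0.
  rewrite inE /idxM; case: ifP => // _ xS.
  by apply: suppA0; rewrite -surjective_pairing.
apply: negligibleS (gaussian_singular_negligible gX (@idxM_inj k) A0u supp) => w /=.
by rewrite idxME.
Qed.

(** With u = t / (2 n), the condition number exceeds t only if A or some M_k is singular or
    has a column whose cofactor expansion is smaller than 1 / u times the sum of its
    absolute terms. The column bound is linear in the number of random entries less
    one, and the sum over the n + 1 matrices gives n * (#|S| - 1): the n columns of A
    count #|S| - n, and in M_k a column of A gives way to b, which has n entries. *)
Lemma cond_lin_tail (t : R) : 2 * n%:R < t ->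
  covered P [set w | (t%:E < cond_lin (A w) (b w))%E]
    (4 * n%:R ^+ 2 * (#|S|%:R - 1) * (gauss_rate s * (1 + s)) / (t - 2 * n%:R)).
Proof.
move=> nt; pose u := t / (2 * n%:R).
have n0 : 0 < n%:R :> R by rewrite ltr0n.
have n20 : 0 < 2 * n%:R :> R by rewrite mulr_gt0.
have u1 : 1 < u by rewrite ltr_pdivlMr// mul1r.
have tE : t = 2 * n%:R * u by rewrite /u mulrC divfK// gt_eqF.
pose kap := gauss_rate s * (2 / (u - 1)) * (1 + s).
have covA j : covered P
    [set w | u * `|\det (A w)| < \sum_i `|A w i j * cofactor (A w) i j|]
    (kap * ((col_size j)%:R - 1)).
  have := cofactor_column_tail gX idxA_inj j u1.
  have -> : [set i | idxA (i, j) \in system_support S]%SET = [set i | (i, j) \in S]%SET.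
    by apply/setP => i; rewrite !inE.
  rewrite -subn1 natrB; last exact: col_size_gt0.
  by apply: coveredS => w /=; rewrite idxAE.
have covM k j : covered P
    [set w | u * `|\det (replace_col (A w) (b w) k)| <
      \sum_i `|replace_col (A w) (b w) k i j * cofactor (replace_col (A w) (b w) k) i j|]
    (kap * (if j == k then n%:R - 1 else (col_size j)%:R - 1)).
  have := cofactor_column_tail gX (@idxM_inj k) j u1.
  have -> : [set i | idxM k (i, j) \in system_support S]%SET =
      if j == k then [set: 'I_n]%SET else [set i | (i, j) \in S]%SET.
    by apply/setP => i; rewrite !inE /idxM /=; case: ifP; rewrite ?inE.
  case: ifP => _.
    rewrite cardsT card_ord -subn1 natrB//.
    by apply: coveredS => w /=; rewrite idxME.
  rewrite -subn1 natrB; last exact: col_size_gt0.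
  by apply: coveredS => w /=; rewrite idxME.
have cov := coveredU (coveredU (negligible_covered singularA)
    (covered_exists (fun k => negligible_covered (singularM k))))
  (coveredU (covered_exists covA)
    (covered_exists (fun k => covered_exists (covM k)))).
have -> : 4 * n%:R ^+ 2 * (#|S|%:R - 1) * (gauss_rate s * (1 + s)) / (t - 2 * n%:R) =
    0 + \sum_(k < n) 0 + (\sum_j kap * ((col_size j)%:R - 1) +
     \sum_k \sum_j kap * (if j == k then n%:R - 1 else (col_size j)%:R - 1)).
  pose N : R := #|S|%:R.
  have sumc : \sum_j ((col_size j)%:R - 1) = N - n%:R :> R.
    by rewrite sumrB sumr_const card_ord -natr_sum sum_col_size.
  have inner k : \sum_j kap * (if j == k then n%:R - 1 else (col_size j)%:R - 1) =
      kap * (n%:R - 1 + (N - n%:R) - ((col_size k)%:R - 1)).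
    rewrite -mulr_sumr (bigD1 k)//= eqxx -sumc [in RHS](bigD1 k)//=.
    rewrite [in RHS]addrCA -!addrA; congr (_ * _).
    rewrite (eq_bigr (fun j => (col_size j)%:R - 1)); last by move=> j /negbTE ->.
    by ring.
  under [X in _ + (_ + X)]eq_bigr do rewrite inner.
  have outer : \sum_(k < n) (n%:R - 1 + (N - n%:R) - ((col_size k)%:R - 1)) =
      n%:R * (n%:R - 1 + (N - n%:R)) - (N - n%:R).
    by rewrite sumrB sumc sumr_const card_ord mulr_natl.
  rewrite -!mulr_sumr outer sumc big1_eq -/N /kap /u.
  by field; rewrite mulN1r subr_eq0 !gt_eqF.
apply: coveredS cov => w /= tc; apply: contrapT => good; move: tc; apply/negP.
rewrite -leNgt.
have dA : \det (A w) != 0 by apply/eqP => dA; apply: good; left; left.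
have Au : A w \in unitmx by rewrite unitmxE unitfE.
have dM k : \det (replace_col (A w) (b w) k) != 0.
  by apply/eqP => dMk; apply: good; left; right; exists k.
have xk k : sol_entry (A w) (b w) k != 0.
  by have := dM k; rewrite det_replace_col// mulf_eq0 negb_or => /andP[].
rewrite /cond_lin Au; apply/bigmax_leP; split; first exact: leNye.
move=> k _; rewrite cond_lin_k_regular// lee_fin tE; apply: skeel_le => // j.
  by rewrite leNgt; apply/negP => H; apply: good; right; left; exists j.
by rewrite leNgt; apply/negP => H; apply: good; right; right; exists k; exists j.
Qed.

End condition_tail.

(** * Expectation of the logarithm *)

Section log_expectation.
Context {d : measure_display} {T : measurableType d} {R : realType}.
Variable P : probability T R.

Lemma integral_expRN :
  (\int[@lebesgue_measure R]_(x in `[0%R, +oo[) (expR (- x))%:E = 1)%E.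
Proof.
pose F : R -> R := fun y => - expR (- y).
have dF (x : R) : is_derive x 1 F (expR (- x)).
  apply: is_derive_eq.
  by rewrite mulrN1 opprK.
rewrite (@ge0_continuous_FTC2y _ _ F 0 0).
- by rewrite /F oppr0 expR0 -EFinB sub0r opprK.
- by move=> x _; exact: expR_ge0.
- apply: continuous_subspaceT => x.
  by apply: continuous_comp; [exact: continuousN|exact: continuous_expR].
- by rewrite -oppr0; apply: cvgN; exact: cvgr_expR.
- by move=> x _; have [] := dF x.
- apply: cvg_at_right_filter; apply: differentiable_continuous.
  by apply/derivable1_diffP; have [] := dF 0.
- by move=> x _; rewrite derive1E; exact: derive_val.
Qed.

Variables (c : T -> \bar R) (tau K m : R).
Hypothesis mc : measurable_fun setT c.
Hypothesis tau1 : 1 <= tau.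
Hypothesis m0 : 0 <= m.
Hypothesis mtau : m < tau.
Hypothesis K0 : 0 <= K.
Hypothesis tail : forall t, tau <= t ->
  (P [set w | t%:E < c w] <= (K / (t - m))%:E)%E.

Let tau0 : 0 < tau. Proof. exact: lt_le_trans tau1. Qed.

Let mlt t : measurable [set w | (t%:E < c w)%E].
Proof. exact: measurable_lte_set. Qed.

(** The value of fine at +oo is 0; this happens on a null set only. *)
Let Y w : R := Num.max 0 (ln (fine (c w) / tau)).

Let mfine : measurable_fun setT (fun w => fine (c w)).
Proof. exact: measurableT_comp. Qed.

Let mY : measurable_fun setT Y.
Proof.
apply: measurable_maxr; first exact: measurable_cst.
apply: measurableT_comp; first exact: measurable_ln.
by apply: measurable_funM.
Qed.

Let exceed (r : R) : 0 <= r ->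
  [set w | r < Y w] `<=` [set w | ((tau * expR r)%:E < c w)%E].
Proof.
move=> r0 w /=; rewrite /Y lt_max ltNge r0 /= => rl.
have z0 : 0 < fine (c w) / tau.
  rewrite ltNge; apply/negP => z0; move: rl; rewrite ln0//.
  by rewrite ltNge r0.
have cw : c w = (fine (c w))%:E.
  by move: z0; case: (c w) => //=; rewrite mul0r ltxx.
rewrite cw lte_fin mulrC -ltr_pdivlMr//.
by rewrite -(lnK z0) ltr_expR.
Qed.

Let measurable_infinite : measurable [set w | c w = +oo%E].
Proof.
rewrite -[X in measurable X]setTI; have := mc measurableT (Y := [set +oo%E]).
by apply; exact: emeasurable_set1.
Qed.

(** By the tail bound at t = tau + K / e, for every e > 0. *)
Let infinite_null : P [set w | c w = +oo%E] = 0%E.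
Proof.
apply/eqP; rewrite eq_le measure_ge0 andbT; apply/lee_addgt0Pr => e e0.
rewrite add0e; pose t := tau + K / e.
have tt : tau <= t by rewrite lerDl divr_ge0// ltW.
apply: (@le_trans _ _ (P [set w | (t%:E < c w)%E])).
  apply: le_measure; rewrite ?inE.
  - exact: measurable_infinite.
  - exact: mlt.
  - by move=> w /= ->; rewrite ltry.
apply: (le_trans (tail tt)); rewrite lee_fin ler_pdivrMr; last first.
  by rewrite subr_gt0 (lt_le_trans mtau).
rewrite /t addrAC mulrDr mulrCA divff ?mulr1 ?gt_eqF//.
by rewrite lerDr mulr_ge0 ?subr_ge0 ?ltW.
Qed.

Let expectation_Y : (\int[P]_w (Y w)%:E <= (K / (tau - m))%:E)%E.
Proof.
pose Y' : {RV P >-> R} := HB.pack Y (isMeasurableFun.Build _ _ _ _ _ mY).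
have Y0 w : 0 <= Y' w by rewrite le_max lexx.
have := ge0_expectation_ccdf Y0; rewrite expectation_def => ->.
have tm0 : 0 < tau - m by rewrite subr_gt0.
have mE (D : set R) : measurable_fun D (fun r : R => (expR (- r))%:E).
  by apply/measurable_EFinP; apply: measurable_funTS; apply: measurableT_comp.
apply: (@le_trans _ _ (\int[lebesgue_measure]_(r in `[0%R, +oo[)
   ((K / (tau - m))%:E * (expR (- r))%:E))%E).
  apply: ge0_le_integral => //.
  - by apply: measurable_funTS; exact: ccdf_measurable.
  - by apply: emeasurable_funM; [exact: measurable_cst|exact: mE].
  - move=> r /=; rewrite in_itv/= andbT => r0.
    rewrite /ccdf /distribution /pushforward.
    apply: (@le_trans _ _ (P [set w | ((tau * expR r)%:E < c w)%E])).
      apply: le_measure; rewrite ?inE//.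
        rewrite -[X in measurable X]setTI; exact: mY.
      by move=> w /=; rewrite in_itv/= andbT => /(exceed r0).
    have e1 : 1 <= expR r by rewrite -expR0 ler_expR.
    have et : tau <= tau * expR r by rewrite ler_peMr// ltW.
    apply: (le_trans (tail et)); rewrite -EFinM lee_fin expRN -mulrA ler_wpM2l//.
    rewrite -invfM lef_pV2 ?posrE ?mulr_gt0 ?expR_gt0//; last first.
      by rewrite subr_gt0 (lt_le_trans mtau).
    by rewrite mulrBl lerD2l lerN2 ler_peMr.
rewrite ge0_integralZl_EFin//.
- by rewrite integral_expRN mule1.
- exact: mE.
- by rewrite divr_ge0// ltW.
Qed.

(** Layer-cake integration of the tail: ln c is at most ln tau plus the positive part Y of
    ln (c / tau), and Y exceeds r only if c exceeds tau * expR r, which has probability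
    at most K / (tau - m) * expR (- r). The negative part of ln c only decreases the
    integral. *)
Lemma log_expectation_tail (beta : R) : 1 < beta ->
  (\int[P]_w logbe beta (c w) <= ((ln tau + K / (tau - m)) / ln beta)%:E)%E.
Proof.
move=> b1; have lb : 0 < ln beta by exact: ln_gt0.
pose h1 w : \bar R :=
  if c w == +oo%E then +oo%E else (Num.max 0 (ln (fine (c w))) / ln beta)%:E.
pose h2 w : \bar R := (Num.max 0 (ln (fine (c w))) / ln beta)%:E.
(* As ln vanishes on nonpositive reals, the positive part has a single formula away
   from +oo. *)
have posE w : (fun w => logbe beta (c w))^\+%E w = h1 w.
  rewrite funeposE /h1 /logbe.
  have ib : ((ln beta)%:E^-1 = (ln beta)^-1%:E)%E by rewrite inver gt_eqF.
  case: (c w) => [r| |] /=.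
  - have [r0|r0] := leP r 0; rewrite ib.
      rewrite gt0_mulNye ?lte_fin ?invr_gt0// ln0// maxxx mul0r.
      by apply/max_idPr; exact: leNye.
    rewrite -EFinM -EFin_max; congr (_%:E).
    by rewrite maxr_pMl ?invr_ge0 ?ltW// mul0r maxC.
  - by rewrite ib gt0_mulye ?lte_fin ?invr_gt0//; apply/max_idPl; exact: leey.
  - rewrite ib gt0_mulNye ?lte_fin ?invr_gt0// ln0// maxxx mul0r.
    by apply/max_idPr; exact: leNye.
have mmax : measurable_fun setT (fun w => Num.max 0 (ln (fine (c w))) / ln beta).
  apply: measurable_funM; last exact: measurable_cst.
  apply: measurable_maxr; first exact: measurable_cst.
  by apply: measurableT_comp; first exact: measurable_ln.
have mh2 : measurable_fun setT h2 by exact/measurable_EFinP.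
have mh1 : measurable_fun setT h1.
  apply: measurable_fun_ifT => //; apply: measurable_fun_eqe => //.
have h20 w : (0 <= h2 w)%E.
  by rewrite lee_fin divr_ge0 ?(ltW lb)// le_max lexx.
have h10 w : (0 <= h1 w)%E.
  by rewrite /h1; case: ifP => _; [exact: leey|exact: h20].
have lt0 : 0 <= ln tau by exact: ln_ge0.
have Y0 w : 0 <= Y w by rewrite le_max lexx.
have h2Y w : (h2 w <= (ln beta)^-1%:E * ((ln tau)%:E + (Y w)%:E))%E.
  rewrite -EFinD -EFinM lee_fin mulrC ler_wpM2l ?invr_ge0 ?(ltW lb)//.
  have [z0|z0] := leP (fine (c w)) 0; first by rewrite ln0// maxxx addr_ge0.
  rewrite ge_max addr_ge0//= -lerBlDl -ln_div ?posrE//.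
  by rewrite le_max lexx orbT.
have mlY : measurable_fun setT (fun w => ((ln tau)%:E + (Y w)%:E)%E).
  by apply: emeasurable_funD; [exact: measurable_cst|exact/measurable_EFinP].
rewrite integralE.
apply: (@le_trans _ _ (\int[P]_w (fun w => logbe beta (c w))^\+%E w)%E).
  by rewrite geeDl// oppe_le0 integral_ge0.
under eq_integral do rewrite posE.
have -> : (\int[P]_w h1 w = \int[P]_w h2 w)%E.
  apply: ge0_ae_eq_integral => //; exists [set w | c w = +oo%E]; split.
  - exact: measurable_infinite.
  - exact: infinite_null.
  - move=> w /= H; apply: contrapT => cw; apply: H => _.
    by rewrite /h1; case: eqP.
apply: (@le_trans _ _ (\int[P]_w ((ln beta)^-1%:E * ((ln tau)%:E + (Y w)%:E)))%E).
  apply: ge0_le_integral => //.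
  by apply: emeasurable_funM; first exact: measurable_cst.
rewrite ge0_integralZl_EFin//; last 2 first.
- by move=> w _; rewrite -EFinD lee_fin addr_ge0.
- by rewrite invr_ge0 ltW.
rewrite ge0_integralD//; last 2 first.
- by move=> w _; rewrite lee_fin.
- exact/measurable_EFinP.
have -> : (\int[P]_w (ln tau)%:E = (ln tau)%:E)%E.
  by rewrite [LHS](integral_cst P measurableT (ln tau)%:E) /= probability_setT mule1.
rewrite [in leRHS]mulrC [leRHS]EFinM lee_wpmul2l ?lee_fin ?invr_ge0 ?(ltW lb)//.
by rewrite EFinD leeD2l//; exact: expectation_Y.
Qed.

End log_expectation.

(** By expR (185 / 800) >= 1 + 185 / 800 >= 1.23 and three squarings. *)
Lemma ln5_le (R : realType) : ln 5 <= 185 / 100 :> R.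
Proof.
rewrite -ler_expR lnK ?posrE//.
have e1 : 123 / 100 <= expR (185 / 800) :> R.
  by apply: le_trans (expR_ge1Dx _); lra.
have -> : expR (185 / 100) = ((expR (185 / 800) ^+ 2) ^+ 2) ^+ 2 :> R.
  by rewrite -!exprM -expRM_natl; congr expR; lra.
have sq (x y z : R) : 0 <= x -> x <= y -> z <= x ^+ 2 -> z <= y ^+ 2.
  by move=> x0 xy zx; rewrite (le_trans zx)// lerXn2r// nnegrE// (le_trans x0).
apply: (sq (228 / 100)); [lra| |lra].
apply: (sq (151 / 100)); [lra| |lra].
by apply: (sq (123 / 100)); [lra|exact: e1|lra].
Qed.

(** * The theorem *)

(* For matrices over R, `|M| is the library norm max_(i, j) `|M i j|. *)
Theorem theorem4 (R : realType) (n : nat) (S : {set 'I_n * 'I_n})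
    (Abar : 'M[R]_n) (bbar : 'cV[R]_n) (sigma : R)
    (d : measure_display) (T : measurableType d) (P : probability T R)
    (A : T -> 'M[R]_n) (b : T -> 'cV[R]_n) :
  (1 <= n)%N ->
  admissible R S ->
  supported_on S Abar ->
  `|Abar| <= 1 ->
  `|bbar| <= 1 ->
  0 < sigma ->
  gaussian_mx P S Abar sigma A ->
  gaussian_mx P [set: 'I_n * 'I_1]%SET bbar sigma b ->
  independent_mx P A b ->
  (forall t : R, 2 * #|S|%:R < t ->
     (P [set w | t%:E < cond_lin (A w) (b w)] <=
      (((1 + sigma) / sigma) *
       ((4 * n%:R * #|S|%:R ^+ 2) / (t - 2 * #|S|%:R)) *
       Num.sqrt (2 / pi))%:E)%E) /\
  (forall beta : R, 1 < beta ->
     (\int[P]_w logbe beta (cond_lin (A w) (b w)) <=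
      (logb beta ((1 + sigma) / sigma) + 2 * logb beta #|S|%:R +
       logb beta n%:R + (265%:R / 100%:R) / ln beta)%:E)%E).
Proof.
move=> n1 admS _ A1 b1 s0 gA gb indAb.
have gX := system_gaussian_family s0 A1 b1 gA gb indAb.
have Sn : (n <= #|S|)%N := admissible_card_ge admS.
have [mA _ _ _] := gA; have [mb _ _ _] := gb.
have mc : measurable_fun setT (fun w => cond_lin (A w) (b w)).
  apply: measurable_cond_lin => [i j|i]; [exact: (mA (i, j))|exact: (mb (i, ord0))].
have mtc (t : R) : measurable [set w | (t%:E < cond_lin (A w) (b w))%E].
  exact: measurable_lte_set.
set N : R := #|S|%:R; set q := (1 + sigma) / sigma.
have nr1 : 1 <= n%:R :> R by rewrite ler1n.
have nN : n%:R <= N by rewrite ler_nat.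
have q1 : 1 <= q by rewrite /q ler_pdivlMr// mul1r lerDr.
have rateE : gauss_rate sigma * (1 + sigma) = q * Num.sqrt (2 / pi).
  by rewrite /gauss_rate /q; ring.
pose k := Num.sqrt (2 / pi) : R.
have k0 : 0 <= k by exact: sqrtr_ge0.
have k1 : k <= 1 by exact: sqrt_2pi_le1.
have tail t : 2 * n%:R < t -> (P [set w | (t%:E < cond_lin (A w) (b w))%E] <=
    (4 * n%:R ^+ 2 * (N - 1) * (q * k) / (t - 2 * n%:R))%:E)%E.
  move=> nt; apply: (covered_measurable (mtc t)).
  by have := cond_lin_tail n1 admS gX nt; rewrite rateE.
have N1 : 1 <= N by exact: le_trans nN.
have n0 : 0 <= n%:R :> R by [].
have nN1 : n%:R * (N - 1) <= N ^+ 2 - N.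
  rewrite (_ : N ^+ 2 - N = N * (N - 1)); last by ring.
  by rewrite ler_wpM2r// subr_ge0.
have q0 : 0 <= q by exact: le_trans q1.
have qk0 : 0 <= q * k by exact: mulr_ge0.
split=> [t Nt|beta b1'].
  have tN : 0 < t - 2 * N by rewrite subr_gt0.
  have tn : t - 2 * N <= t - 2 * n%:R by rewrite lerD2l lerN2 ler_wpM2l.
  have nt : 2 * n%:R < t by rewrite -subr_gt0 (lt_le_trans tN).
  apply: (le_trans (tail t nt)); rewrite lee_fin -/k.
  rewrite (_ : q * (4 * n%:R * N ^+ 2 / (t - 2 * N)) * k =
    4 * n%:R * N ^+ 2 * (q * k) / (t - 2 * N)); last by ring.
  apply: ler_pM.
  - apply: mulr_ge0 qk0; apply: mulr_ge0; last by rewrite subr_ge0.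
    by apply: mulr_ge0 => //; exact: exprn_ge0.
  - by rewrite invr_ge0 (le_trans (ltW tN)).
  - apply: ler_wpM2r => //.
    rewrite (_ : 4 * n%:R ^+ 2 * (N - 1) = 4 * n%:R * (n%:R * (N - 1))); last by ring.
    by apply: ler_wpM2l; [rewrite mulr_ge0|move: nN1 N1; lra].
  - by rewrite lef_pV2 ?posrE// (lt_le_trans tN).
(* The tail is integrated from 5 D on; ln D produces the logarithmic terms, and
   ln 5 + 4 / 5 <= 2.65 remains. *)
pose D := n%:R * N ^+ 2 * q.
have Nq1 : 1 <= N ^+ 2 * q by rewrite mulr_ege1// exprn_ege1.
have nD : n%:R <= D by rewrite /D -mulrA ler_peMr.
have D1 : 1 <= D by exact: le_trans nD.
pose K := 4 * n%:R ^+ 2 * (N - 1) * q.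
have K0 : 0 <= K.
  apply: mulr_ge0 q0; apply: mulr_ge0; last by rewrite subr_ge0.
  by apply: mulr_ge0 => //; exact: exprn_ge0.
have mtau : 2 * n%:R < 5 * D by move: nr1 nD; lra.
have KD : K / (5 * D - 2 * n%:R) <= 8 / 10.
  rewrite ler_pdivrMr ?subr_gt0//.
  have K1 : K <= 4 * D - 4 * (n%:R * (N * q)).
    rewrite (_ : K = 4 * (n%:R * q * (n%:R * (N - 1)))); last by rewrite /K; ring.
    rewrite (_ : 4 * D - _ = 4 * (n%:R * q * (N ^+ 2 - N))); last by rewrite /D; ring.
    by rewrite ler_wpM2l// ler_wpM2l// mulr_ge0.
  have nNq : n%:R <= n%:R * (N * q) by rewrite ler_peMr// mulr_ege1.
  by move: K1 nNq nr1; lra.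
have tau1 : 1 <= 5 * D by move: D1; lra.
have m0 : 0 <= 2 * n%:R :> R by rewrite mulr_ge0.
have tailK t : 5 * D <= t -> (P [set w | (t%:E < cond_lin (A w) (b w))%E] <=
    (K / (t - 2 * n%:R))%:E)%E.
  move=> Dt; have nt := lt_le_trans mtau Dt; apply: (le_trans (tail t nt)).
  rewrite lee_fin ler_wpM2r// ?invr_ge0 ?subr_ge0 ?(ltW nt)//.
  rewrite mulrA ler_piMr//.
apply: (le_trans (log_expectation_tail mc tau1 m0 mtau K0 tailK b1')).
have lb0 : 0 < ln beta by exact: ln_gt0.
rewrite lee_fin /logb -/N -/q.
rewrite (_ : _ + _ + _ + _ = (ln q + 2 * ln N + ln n%:R + 265 / 100) / ln beta); last first.
  by move: (ln q) (ln N) (ln n%:R) (ln beta)^-1 => x y z l; ring.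
rewrite ler_pM2r ?invr_gt0//.
have pos : [/\ 0 < n%:R :> R, 0 < N & 0 < q].
  by split; [exact: lt_le_trans nr1|exact: lt_le_trans N1|exact: lt_le_trans q1].
case: pos => npos Npos qpos.
have lD : ln (5 * D) = ln 5 + (ln n%:R + (ln N + ln N) + ln q).
  have N2 : 0 < N ^+ 2 by rewrite exprn_gt0.
  have L (x y : R) : 0 < x -> 0 < y -> ln (x * y) = ln x + ln y.
    by move=> x0 y0; rewrite lnM ?posrE.
  have nN2 : 0 < n%:R * N ^+ 2 by exact: mulr_gt0.
  have Dpos : 0 < D by exact: mulr_gt0.
  by rewrite L// /D (L _ _ nN2 qpos) (L _ _ npos N2) expr2 L.
rewrite lD; move: (ln5_le R) KD.
move: (ln 5) (ln n%:R) (ln N) (ln q) (K / _) => l5 x y z r.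
by lra.
Qed.
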